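(* Let $\mathbb{K}$ be an algebraically closed uncountable field of characteristic zero. Let $G$ be a connected ind-group over $\mathbb{K}$ and let $H\subset G$ be a closed connected nested ind-subgroup. Assume that for any $g\in G$ there exists a positive integer $d$ such that $g^d\in H$. Then $G=H$.
   Context: An ind-variety $V$ is a set with a filtration $V_0\hookrightarrow V_1\hookrightarrow\cdots$ with $V=\bigcup_k V_k$, each $V_k$ an algebraic variety over $\mathbb{K}$, and each $V_k\hookrightarrow V_{k+1}$ a closed embedding. A subset $S\subset V$ is open (closed) if $S\cap V_k$ is open (closed) in $V_k$ for all $k$; closed subsets are ind-varieties in the induced way. A morphism $\bigcup V_k\to\bigcup W_m$ is a map such that for every $k$ there is $m$ with $V_k$ mapped into $W_m$ by a morphism of varieties. Products are filtered by $X_i\times Y_i$. Another filtration $V=\bigcup_i V_i'$ is admissible if the identity map is an isomorphism of ind-varieties between the two ind-structures. An ind-group is an ind-variety with a group structure such that $(g,h)\mapsto gh^{-1}$ is a morphism; closed subgroups are ind-groups. An algebraic subgroup of an ind-group $G=\bigcup_i G_i$ is a closed subgroup contained in some $G_i$. An ind-group is nested if it admits an admissible filtration by algebraic subgroups. Connectedness of an ind-group $G=\bigcup_k G_k$ is with respect to the topology in which a subset $S\subset G$ is open (closed) if and only if $S\cap G_k$ is Zariski open (closed) in $G_k$ for all $k$. *)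

(* Defs.v *)
From HB Require Import structures.
From mathcomp Require Import all_boot all_algebra.
From mathcomp Require Import all_classical topology.
From mathcomp Require Import mpoly.

Set Implicit Arguments.
Unset Strict Implicit.
Unset Printing Implicit Defensive.

Import GRing.Theory.

Local Open Scope ring_scope.
Local Open Scope classical_set_scope.

(* Algebraic varieties over an algebraically closed field K are taken in the
   sense of Serre: topological spaces with a sheaf of K-valued functions that
   are separated and have a finite cover by open affine subsets. They need not
   be irreducible or affine. *)

Section Spaces.
Variable K : closedFieldType.

(* f is, near each point of U, equal to a member of one of the families P W. *)
Definition locally_in (X : topologicalType) (P : set X -> set (X -> K))
    (U : set X) : set (X -> K) :=
  [set f | forall x, U x -> exists W g,
     [/\ open W, W x, P W g & \forall y \near x, f y = g y]].

(* A topological space with a sheaf of K-algebras of K-valued functions. For U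
   open, [regular U f] means that the restriction of f to U is a section of the
   sheaf; functions are total, and their values outside U are ignored.
   [regular_local] contains restriction, gluing, and independence of the values
   outside U. *)
Record kspace := KSpace {
  kpoints :> topologicalType;
  regular : set kpoints -> set (kpoints -> K);
  regular_local : forall U f, open U ->
    regular U f <-> locally_in regular U f;
  regular_cst : forall U c, open U -> regular U (fun=> c);
  regularD : forall U f g, open U -> regular U f -> regular U g ->
    regular U (fun x => f x + g x);
  regularM : forall U f g, open U -> regular U f -> regular U g ->
    regular U (fun x => f x * g x) }.

Lemma regular_sub (X : kspace) (U V : set X) (f : X -> K) :
  open U -> open V -> V `<=` U -> regular U f -> regular V f.
Proof.
move=> oU oV VU rf; apply/regular_local => // x Vx.
by exists U, f; split=> //; [exact: VU | exact: nearW].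
Qed.

Section KSpaceOf.
Variables (X : topologicalType) (P : set X -> set (X -> K)).
Hypothesis P_cst : forall c, P setT (fun=> c).
Hypothesis P_add : forall W W' g g', open W -> open W' -> P W g -> P W' g' ->
  P (W `&` W') (fun x => g x + g' x).
Hypothesis P_mul : forall W W' g g', open W -> open W' -> P W g -> P W' g' ->
  P (W `&` W') (fun x => g x * g' x).

Fact local_local U f :
  open U -> locally_in P U f <-> locally_in (locally_in P) U f.
Proof.
move=> oU; split=> Pf x Ux.
  by exists U, f; split=> //; apply: nearW.
have [W [g [_ Wx /(_ x Wx)[W' [g' [oW' W'x Pg' gg']]] fg]]] := Pf x Ux.
exists W', g'; split=> //.
by apply: filterS2 fg gg' => y -> ->.
Qed.

Fact local_cst U c : open U -> locally_in P U (fun=> c).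
Proof.
move=> _ x _; exists setT, (fun=> c); split=> //; first exact: openT.
exact: nearW.
Qed.

Fact localD U f g : open U -> locally_in P U f -> locally_in P U g ->
  locally_in P U (fun x => f x + g x).
Proof.
move=> _ Pf Pg x Ux.
have [W [f' [oW Wx Pf' ff']]] := Pf x Ux.
have [W' [g' [oW' W'x Pg' gg']]] := Pg x Ux.
exists (W `&` W'), (fun y => f' y + g' y).
split=> //; [exact: openI | exact: P_add |].
by apply: filterS2 ff' gg' => y -> ->.
Qed.

Fact localM U f g : open U -> locally_in P U f -> locally_in P U g ->
  locally_in P U (fun x => f x * g x).
Proof.
move=> _ Pf Pg x Ux.
have [W [f' [oW Wx Pf' ff']]] := Pf x Ux.
have [W' [g' [oW' W'x Pg' gg']]] := Pg x Ux.
exists (W `&` W'), (fun y => f' y * g' y).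
split=> //; [exact: openI | exact: P_mul |].
by apply: filterS2 ff' gg' => y -> ->.
Qed.

Definition kspace_of : kspace := KSpace local_local local_cst localD localM.

End KSpaceOf.

Definition kmorphism (X Y : kspace) (f : X -> Y) : Prop :=
  continuous f /\
  forall (V : set Y) (g : Y -> K), open V -> regular V g ->
    regular (f @^-1` V) (g \o f).

Definition kisomorphism (X Y : kspace) (f : X -> Y) : Prop :=
  kmorphism f /\
  exists g : Y -> X, [/\ kmorphism g, cancel f g & cancel g f].

Section Subspace.
Variables (X : kspace) (A : set X).

Definition ksub_regular (W : set (set_type A)) : set (set_type A -> K) :=
  [set g | exists (U : set X) (h : X -> K),
    [/\ open U, regular U h & forall y, W y -> U (val y) /\ g y = h (val y)]].

Fact ksub_cst c : ksub_regular setT (fun=> c).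
Proof.
exists setT, (fun=> c); split=> //; first exact: openT.
by apply: regular_cst; exact: openT.
Qed.

Fact ksubD W W' g g' : open W -> open W' ->
  ksub_regular W g -> ksub_regular W' g' ->
  ksub_regular (W `&` W') (fun x => g x + g' x).
Proof.
move=> _ _ [U [h [oU rh gh]]] [U' [h' [oU' rh' gh']]].
have oI : open (U `&` U') by exact: openI.
exists (U `&` U'), (fun x => h x + h' x); split=> //.
  apply: regularD => //; last exact: (regular_sub oU').
  exact: (regular_sub oU).
by move=> y [/gh[Uy ->] /gh'[U'y ->]].
Qed.

Fact ksubM W W' g g' : open W -> open W' ->
  ksub_regular W g -> ksub_regular W' g' ->
  ksub_regular (W `&` W') (fun x => g x * g' x).
Proof.
move=> _ _ [U [h [oU rh gh]]] [U' [h' [oU' rh' gh']]].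
have oI : open (U `&` U') by exact: openI.
exists (U `&` U'), (fun x => h x * h' x); split=> //.
  apply: regularM => //; last exact: (regular_sub oU').
  exact: (regular_sub oU).
by move=> y [/gh[Uy ->] /gh'[U'y ->]].
Qed.

(* The subset A with the induced topology and the functions that are locally
   restrictions of regular functions of X. It is used both for open and for
   closed subsets (the latter with their reduced structure). *)
Definition ksub : kspace := kspace_of ksub_cst ksubD ksubM.

End Subspace.

Definition closed_embedding (X Y : kspace) (f : X -> Y) : Prop :=
  exists Z : set Y, closed Z /\
  exists g : X -> ksub Z, kisomorphism g /\ forall x, f x = val (g x).

Definition zero_locus n (S : set {mpoly K[n]}) : set 'rV[K]_n :=
  [set x | forall p, S p -> meval (x ord0) p = 0].

Definition zariski_open n : set_system 'rV[K]_n :=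
  [set U | exists S : set {mpoly K[n]}, U = ~` zero_locus S].

End Spaces.

(* K^n, under another name so that it carries the Zariski topology. *)
Definition affine_point (K : closedFieldType) (n : nat) : Type := 'rV[K]_n.

Section AffineSpace.
Variables (K : closedFieldType) (n : nat).

Fact zariski_openT : @zariski_open K n setT.
Proof.
exists setT; apply/seteqP; split=> // x _ /(_ 1 Logic.I).
by rewrite meval1; apply/eqP; exact: oner_neq0.
Qed.

Fact zariski_openI : setI_closed (@zariski_open K n).
Proof.
move=> _ _ [S ->] [T ->].
exists [set r | exists p q, [/\ S p, T q & r = p * q]].
rewrite -setCU; congr (~` _); apply/seteqP; split=> x.
  move=> Zx _ [p [q [Sp Tq ->]]]; rewrite mevalM.
  by case: Zx => [/(_ p Sp)|/(_ q Tq)] ->; rewrite ?mul0r ?mulr0.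
move=> Zx; have [|/existsNP[p /not_implyP[Sp px]]] := pselect (zero_locus S x).
  by left.
right=> q Tq; have /eqP : meval (x ord0) (p * q) = 0 by apply: Zx; exists p, q.
by rewrite mevalM mulf_eq0 => /orP[]/eqP.
Qed.

Fact zariski_open_bigU (I : Type) (f : I -> set 'rV[K]_n) :
  (forall i, zariski_open (f i)) -> zariski_open (\bigcup_i f i).
Proof.
move=> /choice[S fS].
exists (\bigcup_i S i); rewrite -[LHS]setCK setC_bigcup; congr (~` _).
apply/seteqP; split=> x.
  by move=> fx p [i _ Sip]; have := fx i Logic.I; rewrite fS setCK; apply.
by move=> Zx i _; rewrite fS setCK => p Sip; apply: Zx; exists i.
Qed.

HB.instance Definition _ := Choice.copy (affine_point K n) 'rV[K]_n.
HB.instance Definition _ := isOpenTopological.Build (affine_point K n)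
  zariski_openT zariski_openI zariski_open_bigU.

Definition affine_regular (W : set (affine_point K n)) :
    set (affine_point K n -> K) :=
  [set g | exists p q : {mpoly K[n]}, forall y, W y ->
    meval (y ord0) q != 0 /\ g y = meval (y ord0) p / meval (y ord0) q].

Fact affine_cst c : affine_regular setT (fun=> c).
Proof.
by exists (mpolyC n c), 1 => y _; rewrite meval1 mevalC divr1 oner_neq0.
Qed.

Fact affineD W W' g g' : open W -> open W' ->
  affine_regular W g -> affine_regular W' g' ->
  affine_regular (W `&` W') (fun x => g x + g' x).
Proof.
move=> _ _ [p [q gE]] [p' [q' gE']]; exists (p * q' + p' * q), (q * q').
move=> y [/gE[q0 ->] /gE'[q'0 ->]].
by rewrite mevalD !mevalM mulf_neq0 ?addf_div.
Qed.

Fact affineM W W' g g' : open W -> open W' ->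
  affine_regular W g -> affine_regular W' g' ->
  affine_regular (W `&` W') (fun x => g x * g' x).
Proof.
move=> _ _ [p [q gE]] [p' [q' gE']]; exists (p * p'), (q * q').
move=> y [/gE[q0 ->] /gE'[q'0 ->]].
by rewrite !mevalM mulf_neq0 ?mulf_div.
Qed.

Definition affine_space : kspace K := kspace_of affine_cst affineD affineM.

End AffineSpace.

(* The set of points of the product of two varieties, under another name since
   it does not carry the product topology. *)
Definition kprod_point (K : closedFieldType) (X Y : kspace K) : Type :=
  (X * Y)%type.

Section Product.
Variables (K : closedFieldType) (X Y : kspace K).

(* h restricts on U x V to an element of the image of O(U) (x) O(V). *)
Definition tensor (U : set X) (V : set Y) (h : X * Y -> K) : Prop :=
  exists (I : finType) (a : I -> X -> K) (b : I -> Y -> K),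
    [/\ forall i, regular U (a i), forall i, regular V (b i)
      & forall x y, U x -> V y -> h (x, y) = \sum_i a i x * b i y].

Fact tensor_cst c : tensor setT setT (fun=> c).
Proof.
exists unit, (fun _ _ => c), (fun _ _ => 1); split=> [_|_|x y _ _].
- by apply: regular_cst; exact: openT.
- by apply: regular_cst; exact: openT.
- by rewrite big_const card_unit /= mulr1 addr0.
Qed.

Fact tensorD U V U' V' h h' : open U -> open V -> open U' -> open V' ->
  tensor U V h -> tensor U' V' h' ->
  tensor (U `&` U') (V `&` V') (fun p => h p + h' p).
Proof.
move=> oU oV oU' oV' [I [a [b [ra rb hE]]]] [I' [a' [b' [ra' rb' hE']]]].
have oUU : open (U `&` U') by exact: openI.
have oVV : open (V `&` V') by exact: openI.
exists (I + I')%type, (fun i => match i with inl i => a i | inr i => a' i end),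
  (fun i => match i with inl i => b i | inr i => b' i end).
split=> [[]i|[]i|x y [Ux U'x] [Vy V'y]].
- exact: (regular_sub oU).
- exact: (regular_sub oU').
- exact: (regular_sub oV).
- exact: (regular_sub oV').
- by rewrite big_sumType hE ?hE'.
Qed.

Fact tensorM U V U' V' h h' : open U -> open V -> open U' -> open V' ->
  tensor U V h -> tensor U' V' h' ->
  tensor (U `&` U') (V `&` V') (fun p => h p * h' p).
Proof.
move=> oU oV oU' oV' [I [a [b [ra rb hE]]]] [I' [a' [b' [ra' rb' hE']]]].
have oUU : open (U `&` U') by exact: openI.
have oVV : open (V `&` V') by exact: openI.
exists (I * I')%type, (fun i x => a i.1 x * a' i.2 x),
  (fun i y => b i.1 y * b' i.2 y).
split=> [i|i|x y [Ux U'x] [Vy V'y]].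
- by apply: regularM => //; [apply: (regular_sub oU)|apply: (regular_sub oU')].
- by apply: regularM => //; [apply: (regular_sub oV)|apply: (regular_sub oV')].
- rewrite hE ?hE' // big_distrlr /= pair_big /=.
  by apply: eq_bigr => i _; rewrite mulrACA.
Qed.

Definition kprod_basic : set_system (X * Y) :=
  [set W | exists (U : set X) (V : set Y) (h : X * Y -> K),
    [/\ open U, open V, tensor U V h & W = (U `*` V) `&` [set p | h p != 0]]].

HB.instance Definition _ := Choice.copy (kprod_point X Y) (X * Y)%type.
HB.instance Definition _ :=
  isSubBaseTopological.Build (kprod_point X Y) kprod_basic id.

Definition kprod_regular (W : set (kprod_point X Y)) :
    set (kprod_point X Y -> K) :=
  [set g | exists (U : set X) (V : set Y) (a h : X * Y -> K),
    [/\ open U, open V, tensor U V a, tensor U V h &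
      forall p, W p -> [/\ U p.1, V p.2, h p != 0 & g p = a p / h p]]].

Fact kprod_cst c : kprod_regular setT (fun=> c).
Proof.
exists setT, setT, (fun=> c), (fun=> 1).
split; [exact: openT|exact: openT|exact: tensor_cst|exact: tensor_cst|].
by move=> p _; split=> //; [exact: oner_neq0|rewrite divr1].
Qed.

Fact kprodD W W' g g' : open W -> open W' ->
  kprod_regular W g -> kprod_regular W' g' ->
  kprod_regular (W `&` W') (fun x => g x + g' x).
Proof.
move=> _ _ [U [V [a [h [oU oV ta th gE]]]]]
  [U' [V' [a' [h' [oU' oV' ta' th' gE']]]]].
exists (U `&` U'), (V `&` V'), (fun p => a p * h' p + a' p * h p),
  (fun p => h p * h' p).
split; [exact: openI|exact: openI| |exact: tensorM|].
  rewrite -[U `&` U']setIid -[V `&` V']setIid.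
  apply: tensorD; [exact: openI|exact: openI|exact: openI|exact: openI| |].
    exact: tensorM.
  by rewrite setIC [V `&` V']setIC; exact: tensorM.
move=> p [/gE[Up Vp h0 ->] /gE'[U'p V'p h'0 ->]].
by split=> //; rewrite ?mulf_neq0 ?addf_div.
Qed.

Fact kprodM W W' g g' : open W -> open W' ->
  kprod_regular W g -> kprod_regular W' g' ->
  kprod_regular (W `&` W') (fun x => g x * g' x).
Proof.
move=> _ _ [U [V [a [h [oU oV ta th gE]]]]]
  [U' [V' [a' [h' [oU' oV' ta' th' gE']]]]].
exists (U `&` U'), (V `&` V'), (fun p => a p * a' p), (fun p => h p * h' p).
split; [exact: openI|exact: openI|exact: tensorM|exact: tensorM|].
move=> p [/gE[Up Vp h0 ->] /gE'[U'p V'p h'0 ->]].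
by split=> //; rewrite ?mulf_neq0 ?mulf_div.
Qed.

(* The product of two varieties: with local charts X, Y affine, this is the
   affine variety with coordinate ring K[X] (x) K[Y]. *)
Definition kprod : kspace K := kspace_of kprod_cst kprodD kprodM.

End Product.

Section Varieties.
Variable K : closedFieldType.

Definition affine_variety (X : kspace K) : Prop :=
  exists n (S : set {mpoly K[n]})
    (f : X -> ksub (zero_locus S : set (affine_space K n))), kisomorphism f.

Definition variety (X : kspace K) : Prop :=
  (exists n (U : 'I_n -> set X),
    [/\ forall i, open (U i), forall i, affine_variety (ksub (U i))
      & forall x, exists i, U i x]) /\
  closed ([set p | p.1 = p.2] : set (kprod X X)).

(* The data of an ind-variety structure on T: the maps V_k -> T stand for the
   inclusions V_k \subset T. *)
Record filtration (T : choiceType) := Filtration {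
  piece : nat -> kspace K;
  inc : forall k, piece k -> T }.

Definition ind_variety (T : choiceType) (V : filtration T) : Prop :=
  [/\ forall k, variety (piece V k),
      forall k, injective (@inc T V k),
      forall x, exists k y, @inc T V k y = x
    & forall k, exists t : piece V k -> piece V k.+1,
        closed_embedding t /\ forall y, inc (t y) = inc y].

Definition ind_morphism (T T' : choiceType) (V : filtration T)
    (V' : filtration T') (f : T -> T') : Prop :=
  forall k, exists m (g : piece V k -> piece V' m),
    kmorphism g /\ forall y, inc (g y) = f (inc y).

Definition ind_prod (T T' : choiceType) (V : filtration T)
    (V' : filtration T') : filtration (T * T')%type :=
  @Filtration (T * T')%type (fun k => kprod (piece V k) (piece V' k))
    (fun k p => (inc p.1, inc p.2)).

Definition ind_sub (T : choiceType) (V : filtration T) (A : set T) :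
    filtration (set_type A) :=
  @Filtration (set_type A) (fun k => ksub (@inc T V k @^-1` A))
    (fun k y => exist _ (inc (val y)) (mem_set (set_valP y))).

(* Two ind-variety structures on T define the same ind-variety: each is an
   admissible filtration for the other. *)
Definition admissible (T : choiceType) (V V' : filtration T) : Prop :=
  ind_morphism V V' id /\ ind_morphism V' V id.

End Varieties.

(* T with the topology defined by the filtration V. *)
Definition ind_point (K : closedFieldType) (T : choiceType)
  (V : filtration K T) : Type := T.

Section IndTopology.
Variables (K : closedFieldType) (T : choiceType) (V : filtration K T).

Definition ind_open : set_system T :=
  [set S | forall k, open (@inc K T V k @^-1` S)].

Fact ind_openT : ind_open setT.
Proof. by move=> k; exact: openT. Qed.

Fact ind_openI : setI_closed ind_open.
Proof. by move=> A B oA oB k; exact: openI. Qed.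

Fact ind_open_bigU (I : Type) (f : I -> set T) :
  (forall i, ind_open (f i)) -> ind_open (\bigcup_i f i).
Proof.
by move=> of_ k; rewrite preimage_bigcup; apply: bigcup_open => i _; apply: of_.
Qed.

HB.instance Definition _ := Choice.copy (ind_point V) T.
HB.instance Definition _ := isOpenTopological.Build (ind_point V)
  ind_openT ind_openI ind_open_bigU.

End IndTopology.

Record subgroup (G : groupType) := Subgroup {
  subgroup_set :> set G;
  subgroup_closed : group_closed (fun x => x \in subgroup_set) }.

Definition subgroup_type (G : groupType) (H : subgroup G) : Type := set_type H.

HB.instance Definition _ (G : groupType) (H : subgroup G) :=
  SubChoice.copy (subgroup_type H) {x | x \in subgroup_set H}.
HB.instance Definition _ (G : groupType) (H : subgroup G) :=
  SubChoice_isSubGroup.Build G _ (subgroup_type H) (subgroup_closed H).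

(* The ind-structure induced by V on the subgroup H of G. *)
Definition ind_subgroup (K : closedFieldType) (G : groupType)
    (V : filtration K G) (H : subgroup G) : filtration K (subgroup_type H) :=
  ind_sub V H.

Section IndGroups.
Variables (K : closedFieldType) (G : groupType) (V : filtration K G).

Definition ind_group : Prop :=
  ind_variety V /\ ind_morphism (ind_prod V V) V (fun p => p.1 * p.2^-1)%g.

Definition ind_closed (A : set G) : Prop := closed (A : set (ind_point V)).

Definition ind_connected : Prop := connected [set: ind_point V].

Definition algebraic_subgroup (A : set G) : Prop :=
  [/\ group_closed (mem A), ind_closed A
    & exists i, A `<=` range (@inc K G V i)].

Definition nested : Prop :=
  exists V' : filtration K G,
    [/\ ind_variety V', admissible V V'
      & forall i, algebraic_subgroup (range (@inc K G V' i))].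

End IndGroups.

(* Main.v *)
(* Write H as the increasing union of closed algebraic subgroups H_n. By
   connectedness of G it is enough that H is open, and by translation that each
   piece G_k contains a neighbourhood of 1 lying in H. The closed sets
   {x in G_k | x^(n!) in H_n} increase and cover G_k; as the field is
   uncountable, one of them is a neighbourhood of 1. Put A := H_n, d := n!, and
   let J be the ideal of A in the local ring at 1 of a piece containing A and
   G_k, with maximal ideal m. For f in J, the function f(xy) - f(x) - f(y)
   vanishes on A x A and on both axes, hence f(x^d) - d f(x) lies in m J. Since
   f(x^d) = 0 on G_k and d is invertible, Nakayama's lemma gives J = 0 on G_k
   near 1, so that G_k is contained in A near 1. *)

Require Import Defs.
From mathcomp Require Import all_boot all_order all_algebra.
From mathcomp Require Import all_classical topology.
From mathcomp Require Import mpoly.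
From mathcomp Require Import ring.

Set Implicit Arguments.
Unset Strict Implicit.
Unset Printing Implicit Defensive.

Import Order.TTheory GRing.Theory.

Local Open Scope ring_scope.
Local Open Scope classical_set_scope.

(** * Hilbert's basis theorem *)

(** The inclusion in m J is a statement about tensors. Let O be the local ring at 1. A function in O
    ⊗ O that vanishes on both axes lies in m ⊗ m, and its vanishing on A x A puts it into J ⊗ m + m
    ⊗ J, which the diagonal sends into m J. This applies to f(x^j y) - f(x^j) - f(y) for each j < d;
    setting y = x and summing over j gives f(x^d) - d f(x). Two obstacles shape the argument.
    Products of points of a piece lie only in a larger piece, so f must first be extended there
    without losing its zeros on A. And f(x^j y) is a fraction of elements of O ⊗ O, so a denominator
    is carried along until the diagonal is reached, where it is inverted. Uncountability enters
    through a Nullstellensatz with countably many conditions p_i(x) != 0. *)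

Lemma monotone_subsequence (u : nat -> nat) :
  exists g : nat -> nat, {homo g : i j / (i < j)%N} /\
    {homo u \o g : i j / (i <= j)%N}.
Proof.
(* [next k] is a point of [k, oo) where [u] attains its minimum over that tail, so no later choice
   can have a smaller value. *)
have /choice[next nextP] k :
    exists m, (k <= m)%N /\ forall j, (k <= j)%N -> (u m <= u j)%N.
  have ex : exists v, `[< exists2 m, (k <= m)%N & u m = v >].
    by exists (u k); apply/asboolP; exists k.
  have [v /asboolP[m km <-] vmin] := ex_minnP ex.
  by exists m; split=> // j kj; apply: vmin; apply/asboolP; exists j.
pose g := fix g i := if i is i'.+1 then next (g i').+1 else next 0%N.
have gS i : (g i < g i.+1)%N by case: (nextP (g i).+1).
have gmono : {homo g : i j / (i < j)%N} by apply: homo_ltn => // ? ? ?; apply: ltn_trans.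
exists g; split=> //; apply: homo_leq => [//|? ? ?|i /=]; first exact: leq_trans.
case: i => [|i] /=; first by apply: (nextP 0%N).2.
apply: (nextP (g i).+1).2; apply: ltnW; exact: (leq_ltn_trans (gS i) (gS i.+1)).
Qed.

Lemma dickson_pair n (u : nat -> 'X_{1..n}) :
  exists i j, (i < j)%N /\ (u i <= u j)%MM.
Proof.
(* Subsequences are extracted one coordinate at a time: after [k] rounds the first [k] exponents are
   nondecreasing, and further extraction preserves this. *)
suff /(_ n)[g [gmono ug]] k : exists g : nat -> nat, {homo g : i j / (i < j)%N} /\
    forall l : 'I_n, (l < k)%N -> {homo (fun i => u (g i) l) : i j / (i <= j)%N}.
  exists (g 0%N), (g 1%N); split; first exact: gmono.
  by apply/mnm_lepP => l; apply: ug.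
elim: k => [|k [g [gmono ug]]]; first by exists id; split=> // l; rewrite ltn0.
have [kn|nk] := ltnP k n; last first.
  by exists g; split=> // l _; apply: ug; apply: leq_trans nk.
have [h [hmono uh]] := monotone_subsequence (fun i => u (g i) (Ordinal kn)).
exists (g \o h); split=> [i j ij|l]; first exact/gmono/hmono.
rewrite ltnS leq_eqVlt => /predU1P[lk|lk] i j ij.
  have -> : l = Ordinal kn by exact: val_inj.
  exact: uh.
apply: ug => //; move: ij; rewrite leq_eqVlt => /predU1P[->//|ij].
exact/ltnW/hmono.
Qed.

(** Otherwise one could keep choosing a monomial of [S] that no earlier choice divides, against
    [dickson_pair]. *)
Lemma dickson n (S : set 'X_{1..n}) :
  exists s : seq 'X_{1..n}, {in s, forall m, S m} /\
    forall m, S m -> exists2 m', m' \in s & (m' <= m)%MM.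
Proof.
apply: contrapT => /forallNP noS.
have /choice[next nextP] (s : seq 'X_{1..n}) : exists m,
    {in s, forall m, S m} -> S m /\ forall m', m' \in s -> ~~ (m' <= m)%MM.
  have [sS|?] := pselect {in s, forall m, S m}; last by exists 0%MM.
  have /existsNP[m /not_implyP[Sm nm]] : ~ forall m, S m ->
      exists2 m', m' \in s & (m' <= m)%MM by move=> ?; apply: (noS s).
  exists m => _; split=> // m' m's; apply/negP => le; apply: nm; by exists m'.
pose s := fix s k := if k is k'.+1 then next (s k') :: s k' else [::].
have sS k : {in s k, forall m, S m}.
  elim: k => [|k IH] m //=; rewrite inE => /predU1P[->|/IH//].
  by have [] := nextP (s k) IH.
have [i [j [ij le]]] := dickson_pair (fun k => next (s k)).
have [_ /(_ (next (s i)))] := nextP _ (sS j).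
rewrite le => notin; suff /notin : next (s i) \in s j by [].
elim: j ij {le notin} => // j IH; rewrite ltnS leq_eqVlt => /predU1P[->|/IH ij] /=.
  exact: mem_head.
by rewrite inE ij orbT.
Qed.

Definition ideal (R : comNzRingType) (I : set R) : Prop :=
  [/\ I 0, forall p q, I p -> I q -> I (p + q) & forall p q, I q -> I (p * q)].

Lemma ideal_sum (R : comNzRingType) (I : set R) (J : Type) (r : seq J)
    (P : pred J) (F : J -> R) :
  ideal I -> (forall j, P j -> I (F j)) -> I (\sum_(j <- r | P j) F j).
Proof. by case=> I0 ID _ IF; apply: big_ind. Qed.

(** The generators form a Groebner basis: by Dickson's lemma finitely many leading monomials of [I]
    divide all the others, and the division algorithm terminates because the monomial order is a
    well-order. *)
Lemma hilbert_basis (K : fieldType) n (I : set {mpoly K[n]}) : ideal I ->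
  exists (r : nat) (q : 'I_r -> {mpoly K[n]}), (forall i, I (q i)) /\
    forall p, I p -> exists c : 'I_r -> {mpoly K[n]}, p = \sum_i c i * q i.
Proof.
move=> [I0 ID IM].
have [s [sI sP]] := dickson [set mlead p | p in [set p | I p /\ p != 0]].
have /choice[q qP] (i : 'I_(size s)) : exists p, [/\ I p, p != 0 & mlead p = tnth (in_tuple s) i].
  by have /sI[p [Ip p0] pm] := mem_tnth i (in_tuple s); exists p.
exists (size s), q; split=> [i|p]; first by have [] := qP i.
elim/mleadrect: p => p IH Ip.
have [->|p0] := eqVneq p 0.
  by exists (fun=> 0); rewrite big1 // => i _; rewrite mul0r.
have /sP[m /(tnthP (in_tuple s))[i ->] le] : [set mlead p | p in [set p | I p /\ p != 0]] (mlead p).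
  by exists p.
have [Iq q0 qm] := qP i; rewrite -{}qm in le.
(* The term for which [c * q i] has the same leading term as [p], so that the difference is zero or
   has a smaller leading monomial. *)
pose c := (mleadc p / mleadc (q i)) *: 'X_[(mlead p - mlead (q i))%MM] : {mpoly K[n]}.
have qi0 : mleadc (q i) != 0 by rewrite mleadc_eq0.
have cq0 : mleadc p / mleadc (q i) != 0 by rewrite mulf_neq0 ?invr_eq0 ?mleadc_eq0.
have X0 : 'X_[(mlead p - mlead (q i))%MM] != 0 :> {mpoly K[n]}.
  by rewrite -mleadc_eq0 mleadXm mcoeffX eqxx oner_neq0.
have c0 : c != 0 by rewrite scaler_eq0 negb_or cq0.
have lc : mlead c = (mlead p - mlead (q i))%MM by rewrite mleadZ // mleadXm.
have lcq : mlead (c * q i) = mlead p by rewrite mleadM // lc submK.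
have [d pE] : exists d : 'I_(size s) -> {mpoly K[n]}, p - c * q i = \sum_i d i * q i.
  have [->|p'0] := eqVneq (p - c * q i) 0.
    by exists (fun=> 0); rewrite big1 // => j _; rewrite mul0r.
  apply: IH; last by apply: ID => //; rewrite -mulNr; apply: IM.
  rewrite lt_neqAle; apply/andP; split; last first.
    by rewrite (le_trans (mleadB_le _ _)) // lcq joinxx.
  apply: contraNneq p'0 => lE; rewrite -mleadc_eq0 lE mcoeffB -{2}lcq.
  rewrite mleadM // mleadcM mleadcZE mleadXm mcoeffX eqxx mulr1 divfK //.
  by rewrite subrr.
exists (fun j => d j + (if j == i then c else 0)).
under eq_bigr do rewrite mulrDl; rewrite big_split /= -pE.
rewrite [X in _ + X](bigD1 i) //= eqxx [X in _ + (_ + X)]big1 ?addr0 ?subrK //.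
by move=> j /negbTE ->; rewrite mul0r.
Qed.

(** * Points over an uncountable field *)

Lemma Zorn_chain (T : Type) (P : set (set T)) : P !=set0 ->
  (forall F : set (set T), F !=set0 -> F `<=` P -> total_on F subset ->
    P (\bigcup_(X in F) X)) ->
  exists A, P A /\ forall B, A `<=` B -> P B -> B `<=` A.
Proof.
move=> [A0 PA0] totP.
(* [Zorn_bigcup] also asks for the union of the empty chain, hence [set0] is adjoined to the family
   and discarded afterwards. *)
have [F FP Ftot|A [PA Amax]] := @Zorn_bigcup T [set A | A = set0 \/ P A].
  have [[X [FX PX]]|/forallNP noP] := pselect (exists X, F X /\ P X).
    right; have -> : \bigcup_(X in F) X = \bigcup_(X in F `&` P) X.
      apply/seteqP; split=> x [Y FY Yx]; last by exists Y => //; case: FY.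
      by exists Y => //; split=> //; case: (FP Y FY) Yx => [->|].
    apply: totP; [by exists X | by move=> Y [] |].
    by move=> Y Z [FY _] [FZ _]; apply: Ftot.
  left; apply/seteqP; split=> // x [X FX Xx].
  by have [XE|PX] := FP X FX; [rewrite -XE | case: (noP X)].
have {}PA : P A.
  case: PA Amax => // -> Amax; have [<-|A0n] := pselect (A0 = set0); first exact: PA0.
  case: (Amax A0); last by right.
  by split=> // A00; apply: A0n; apply/seteqP; split.
exists A; split=> // B AB PB; apply: contrapT => BA.
by apply: (Amax B); [split | right].
Qed.

Lemma ideal_chain (R : comNzRingType) (F : set (set R)) :
  F !=set0 -> total_on F subset -> (forall X, F X -> ideal X) ->
  ideal (\bigcup_(X in F) X).
Proof.
move=> [X FX] tot idF; split.
- by exists X => //; case: (idF X FX).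
- move=> p q [Y FY Yp] [Z FZ Zq].
  have [YZ|ZY] := tot Y Z FY FZ.
    by exists Z => //; have [_ ZD _] := idF Z FZ; apply: ZD => //; apply: YZ.
  by exists Y => //; have [_ YD _] := idF Y FY; apply: YD => //; apply: ZY.
- by move=> p q [Y FY Yq]; exists Y => //; have [_ _ YM] := idF Y FY; apply: YM.
Qed.

Lemma ideal_add (R : comNzRingType) (I : set R) (r : R) :
  ideal I -> ideal [set x | exists a p, I p /\ x = a * r + p].
Proof.
move=> [I0 ID IM]; split=> [|_ _ [a [p [Ip ->]]] [b [q [Iq ->]]]|x _ [a [p [Ip ->]]]].
- by exists 0, 0; rewrite mul0r addr0.
- by exists (a + b), (p + q); split; [exact: ID | rewrite mulrDl addrACA].
- by exists (x * a), (x * p); split; [exact: IM | rewrite mulrDr mulrA].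
Qed.

(** For multiplicative [M], this [P] is the trace on [R] of a maximal ideal of the localization at
    [M]; the last clause says that an element outside [P] becomes invertible in the residue
    field. *)
Lemma maximal_avoiding (R : comNzRingType) (I M : set R) :
  ideal I -> (forall x, M x -> ~ I x) ->
  exists P, [/\ ideal P, I `<=` P, forall x, M x -> ~ P x &
    forall r, ~ P r -> exists a p, P p /\ M (a * r + p)].
Proof.
move=> idI MI; have idD := @ideal_add R.
have [||P [[idP IP MP] Pmax]] := @Zorn_chain R
    [set A | [/\ ideal A, I `<=` A & forall x, M x -> ~ A x]].
- by exists I; split.
- move=> F [X FX] FP tot; split.
  + by apply: ideal_chain => //; [exists X | move=> Y /FP[]].
  + by move=> x Ix; exists X => //; have [_ + _] := FP X FX; apply.
  + by move=> x Mx [Y FY Yx]; have [_ _ /(_ x Mx)] := FP Y FY.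
exists P; split=> // r Pr; apply: contrapT => noM; apply: Pr.
apply: (Pmax [set x | exists a p, P p /\ x = a * r + p]).
- by move=> p Pp; exists 0, p; rewrite mul0r add0r.
- split; first exact: idD.
    by move=> p /IP Pp; exists 0, p; rewrite mul0r add0r.
  by move=> x Mx [a [p [Pp xE]]]; apply: noM; exists a, p; rewrite -xE.
- by exists 1, 0; rewrite mul1r addr0; case: idP.
Qed.

(** The union of a chain of ideals is finitely generated, and a single member of the chain already
    contains all generators, so the union is that member. *)
Lemma noetherian_max (K : fieldType) n (F : set (set {mpoly K[n]})) :
  F !=set0 -> (forall X, F X -> ideal X) ->
  exists A, F A /\ forall B, A `<=` B -> F B -> B `<=` A.
Proof.
move=> F0 idF; apply: Zorn_chain => // C [X CX] CF tot.
have idU : ideal (\bigcup_(X in C) X).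
  by apply: ideal_chain => //; [exists X | move=> Y /CF/idF].
have [r [q [qU qP]]] := hilbert_basis idU.
suff [Y [CY qY]] : exists Y, C Y /\ forall i, Y (q i).
  suff -> : \bigcup_(X in C) X = Y by exact: CF.
  apply/seteqP; split=> [p /qP[c ->]|p Yp]; last by exists Y.
  have idY := idF _ (CF _ CY); apply: ideal_sum => // i _.
  by case: idY => _ _; apply; apply: qY.
elim: r q qU {qP} => [|r IH] q qU; first by exists X; split=> // -[].
have [Y [CY qY]] := IH (fun i => q (lift ord0 i)) (fun i => qU _).
have [Z CZ qZ] := qU ord0.
have [YZ|ZY] := tot Y Z CY CZ.
  by exists Z; split=> // i; case: (unliftP ord0 i) => [j|] -> //; apply: YZ.
by exists Y; split=> // i; case: (unliftP ord0 i) => [j|] -> //; apply: ZY.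
Qed.

Lemma uncountable_fiber (T : choiceType) (C : countType) (g : T -> C) :
  ~ countable [set: T] -> exists y, infinite_set (g @^-1` [set y]).
Proof.
move=> uT; apply: contrapT => /forallNP fin; apply: uT.
have -> : [set: T] = \bigcup_(y in [set: C]) (g @^-1` [set y]).
  by apply/seteqP; split=> // x _; exists (g x).
apply: bigcup_countable => [|y _]; first exact: countableP.
by apply: finite_set_countable; apply: contrapT; apply: fin.
Qed.

Lemma infinite_set_seq (T : choiceType) (A : set T) n : infinite_set A ->
  exists s : n.-tuple T, uniq s /\ forall i, A (tnth s i).
Proof.
move=> /(infinite_set_fset n)[B BA sB].
have sz : size (take n (finmap.enum_fset B)) == n by rewrite size_takel.
exists (Tuple sz); split=> [|i]; first by rewrite take_uniq // finmap.fset_uniq.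
by apply: BA; have /mem_take := mem_tnth i (Tuple sz).
Qed.

Lemma bounded_dependence (K : fieldType) n D :
  exists N, forall a : 'I_N -> {mpoly K[n]}, (forall j, (msize (a j) <= D)%N) ->
    exists v : 'I_N -> K, (exists j, v j != 0) /\ \sum_j v j *: a j = 0.
Proof.
(* [msize] is the degree plus one, so only monomials of degree below [D] occur; [N] counts them, and
   [N.+1] coefficient rows of length [N] are dependent. *)
pose N := #|{: 'X_{1..n < D}}|; exists N.+1 => a aD.
pose M := \matrix_(j < N.+1, k < N) (a j)@_(enum_val k : 'X_{1..n < D}).
have : kermx M != 0.
  by rewrite kermx_eq0 /row_free neq_ltn ltnS rank_leq_col.
move=> /rowV0Pn[v /sub_kermxP vM v0]; exists (v ord0); split.
  by move: v0 => /rV0Pn.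
apply/mpolyP => m; rewrite mcoeff0 linear_sum /=.
have [mD|Dm] := ltnP (mdeg m) D.
  have /rowP/(_ (enum_rank (BMultinom mD))) := vM.
  rewrite [LHS]mxE [RHS]mxE; apply: etrans; apply: eq_bigr => j _.
  by rewrite mcoeffZ mxE enum_rankK.
rewrite big1 // => j _; rewrite mcoeffZ memN_msupp_eq0 ?mulr0 //.
exact/msize_mdeg_ge/(leq_trans (aD j)).
Qed.

Section GenericPoint.
Variables (K : closedFieldType) (n : nat) (P M : set {mpoly K[n]}).
Variables (C : countType) (gen : C -> {mpoly K[n]}).
Hypothesis uncountableK : ~ countable [set: K].
Hypothesis idP : ideal P.
Hypothesis ME : M = range gen.
Hypothesis M_mul : forall x y, M x -> M y -> M (x * y).
Hypothesis MP : forall x, M x -> ~ P x.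
Hypothesis Pmax : forall r, ~ P r -> exists a p, P p /\ M (a * r + p).

(* Otherwise every x_i - c is invertible modulo P up to an element of M;
   uncountably many of the inverses share their denominator and a bound on
   their degree, so they are linearly dependent, and clearing denominators
   makes x_i a root of a nonzero univariate polynomial modulo P. *)
Lemma coordinate_value (i : 'I_n) : exists c, P ('X_i - c%:MP).
Proof.
have [P0 PD PM] := idP; apply: contrapT => /forallNP noc.
have /choice[w wP] c : exists w : {mpoly K[n]} * C, P (gen w.2 - w.1 * ('X_i - c%:MP)).
  have [a [p [Pp]]] := Pmax (noc c).
  rewrite ME => -[k _ kE]; exists (a, k); rewrite /= kE addrC addKr; exact: Pp.
have [[k D] fib] := uncountable_fiber (fun c => ((w c).2, msize (w c).1)) uncountableK.
have [N dep] := bounded_dependence K n D.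
have [s [us sP]] := infinite_set_seq N fib.
have [|v [[j0 vj0] vE]] := dep (fun j => (w (tnth s j)).1).
  by move=> j; have [_ <-] := sP j.
(* The numerator of the sum of the [v j / (X - s_j)]; at [s_j0] only the term of index [j0]
   survives, which shows that [q] is nonzero. *)
pose q : {poly K} := \sum_j v j *: \prod_(l | l != j) ('X - (tnth s l)%:P).
have q0 : q != 0.
  apply/eqP => /(congr1 (horner_eval (tnth s j0))); rewrite /q linear_sum /= linear0.
  rewrite (bigD1 j0) //= [X in _ + X]big1 => [|j jj0].
    rewrite addr0 /horner_eval hornerZ horner_prod => /eqP.
    rewrite mulf_eq0 (negbTE vj0) /= => /prodf_eq0[l lj0].
    rewrite hornerXsubC subr_eq0 => /eqP/(tuple_uniqP _ us) lE.
    by rewrite lE eqxx in lj0.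
  rewrite /horner_eval hornerZ horner_prod (bigD1 j0) 1?eq_sym //=.
  by rewrite hornerXsubC subrr mul0r mulr0.
pose ev := horner_alg ('X_i : {mpoly K[n]}).
have evX c : ev ('X - c%:P) = 'X_i - c%:MP.
  by rewrite /ev rmorphB /= horner_algX horner_algC alg_mpolyC.
have Pq : P (gen k * ev q).
  have -> : gen k * ev q = \sum_j v j *: ev (\prod_(l | l != j) ('X - (tnth s l)%:P)) *
      (gen k - (w (tnth s j)).1 * ('X_i - (tnth s j)%:MP)).
    transitivity (gen k * ev q - ev (\prod_l ('X - (tnth s l)%:P)) *
       \sum_j v j *: (w (tnth s j)).1).
      by rewrite vE mulr0 subr0.
    rewrite /q /ev linear_sum !mulr_sumr -sumrB; apply: eq_bigr => j _ /=.
    rewrite linearZ /= [\prod_l _](bigD1 j) //= rmorphM /= -/ev evX mulrBr.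
    by rewrite -!mul_mpolyC; congr (_ - _); ring.
  apply: ideal_sum => // j _; apply: PM.
  by have [<- _] := sP j; apply: wP.
have [r rE] := closed_field_poly_normal q.
(* [q] splits over the algebraically closed [K]. Each factor is cancelled against its inverse modulo
   [P], at the price of enlarging [m] within [M], until an element of [M] lies in [P]. *)
suff noP (m : {mpoly K[n]}) : M m -> ~ P (m * \prod_(z <- r) ('X_i - z%:MP)).
  apply: (noP (gen k)); first by rewrite ME; exists k.
  have <- : (lead_coef q)^-1%:MP * ev q = \prod_(z <- r) ('X_i - z%:MP).
    rewrite mul_mpolyC {2}rE /ev linearZ /= mulr_algl scalerA mulVf ?lead_coef_eq0 // scale1r.
    by rewrite rmorph_prod; apply: eq_bigr => z _; apply: evX.
  by rewrite mulrCA; apply: PM.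
elim: r m {rE} => [|z r IH] m Mm; first by rewrite big_nil mulr1; apply: MP.
rewrite big_cons => Pm; apply: (IH (m * gen (w z).2)).
  by apply: M_mul => //; rewrite ME; exists (w z).2.
have -> : m * gen (w z).2 * \prod_(z0 <- r) ('X_i - z0%:MP) =
    (w z).1 * (m * (('X_i - z%:MP) * \prod_(z0 <- r) ('X_i - z0%:MP))) +
    m * \prod_(z0 <- r) ('X_i - z0%:MP) * (gen (w z).2 - (w z).1 * ('X_i - z%:MP)).
  by ring.
by apply: PD; apply: PM.
Qed.

End GenericPoint.

(** Inverting countably many [f i] yields an algebra of countable dimension, whose residue fields
    are still [K] when [K] is uncountable. The finite products of the [f i] are indexed by lists of
    integers, hence countable, and the coordinates modulo [P] are those of the point sought. *)
Lemma generic_point (K : closedFieldType) n (I : set {mpoly K[n]})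
    (f : nat -> {mpoly K[n]}) :
  ~ countable [set: K] -> ideal I -> (forall s, ~ I (\prod_(i <- s) f i)) ->
  exists x : 'rV[K]_n, (forall p, I p -> meval (x ord0) p = 0) /\
    forall i, meval (x ord0) (f i) != 0.
Proof.
move=> uK idI fI; pose gen s := \prod_(i <- s) f i.
have [_ [s _ <-]|P [idP IP MP Pmax]] := maximal_avoiding (M := range gen) idI.
  exact: fI.
have Mmul x y : range gen x -> range gen y -> range gen (x * y).
  by move=> [s _ <-] [t _ <-]; exists (s ++ t) => //; rewrite /gen big_cat.
have /choice[c cP] := coordinate_value uK idP erefl Mmul MP Pmax.
have [P0 PD PM] := idP.
pose x : 'rV[K]_n := \row_i c i.
pose Q (u v : {mpoly K[n]}) := P (u - v).
have QM u v u' v' : Q u v -> Q u' v' -> Q (u * u') (v * v').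
  move=> Quv Quv'; rewrite /Q.
  have -> : u * u' - v * v' = u' * (u - v) + v * (u' - v') by ring.
  by apply: PD; apply: PM.
have px p : P (p - (meval (x ord0) p)%:MP).
  elim/mpolyind: p => [|a m p _ _ IH]; first by rewrite meval0 subrr.
  rewrite mevalD rmorphD /= opprD addrACA; apply: PD => //.
  rewrite mevalZ rmorphM /= -mul_mpolyC -mulrBr; apply: PM.
  rewrite mevalX mpolyXE_id rmorph_prod /=.
  apply: (big_rec2 Q) => [|i u v _ Quv]; first by rewrite /Q subrr.
  apply: (QM) => //; rewrite rmorphXn /= mxE.
  elim: (m i) => [|k Qk]; first by rewrite !expr0 /Q subrr.
  by rewrite !exprS; apply: (QM) => //; apply: cP.
exists x; split=> [p /IP Pp|i]; last first.
  apply/eqP => fx; apply: (MP (f i)); first by exists [:: i] => //; rewrite /gen big_seq1.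
  by have := px (f i); rewrite fx mpolyC0 subr0.
(* A nonzero value of [p] would be a unit congruent to an element of [P], whereas 1 is the empty
   product of the [f i]. *)
apply: contrapT => /eqP p0; apply: (MP 1); first by exists [::] => //; rewrite /gen big_nil.
have -> : 1 = (meval (x ord0) p)^-1%:MP * (p - (p - (meval (x ord0) p)%:MP)) :> {mpoly K[n]}.
    by rewrite opprB addrCA subrr addr0 -mpolyCM mulVf.
by apply/PM/PD => //; rewrite -mulN1r; apply/PM.
Qed.

(** * Germs of regular functions *)

Lemma nbhs_openP (T : topologicalType) (x : T) (P : set T) :
  nbhs x P <-> exists N, [/\ open N, N x & N `<=` P].
Proof.
rewrite nbhsE; split=> [[N [oN Nx] NP]|[N [oN Nx NP]]]; first by exists N.
by exists N.
Qed.

Lemma nbhsW (T : topologicalType) (x : T) (P : set T) :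
  (forall y, P y) -> nbhs x P.
Proof. by move=> allP; apply: nearW. Qed.

Lemma continuous_nbhs (S T : topologicalType) (f : S -> T) (x : S) (N : set T) :
  continuous f -> nbhs (f x) N -> nbhs x (f @^-1` N).
Proof. by move=> cf; apply: cf. Qed.

Section Germs.
Variable K : closedFieldType.

(** The local ring at [x] is not formed as a quotient: a germ is represented by any total function
    regular around [x], and equality of germs is equality near [x]. *)
Definition regular_at (X : kspace K) (x : X) (f : X -> K) : Prop :=
  exists U, [/\ open U, U x & regular U f].

Implicit Types X Y : kspace K.

Lemma regular_at_near X (x : X) f g :
  (\forall y \near x, f y = g y) -> regular_at x f -> regular_at x g.
Proof.
move=> /nbhs_openP[N [oN Nx fg]] [U [oU Ux rf]].
exists (U `&` N); split; [exact: openI | by split |].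
apply/regular_local; first exact: openI.
move=> y [Uy Ny]; exists U, f; split=> //; apply/nbhs_openP; exists N; split=> //.
by move=> w /fg.
Qed.

Lemma regular_openP X (U : set X) f : open U ->
  regular U f <-> forall x, U x -> regular_at x f.
Proof.
move=> oU; split=> [rf x Ux|rf]; first by exists U.
apply/regular_local => // x Ux; have [W [oW Wx rW]] := rf x Ux.
by exists W, f; split=> //; apply: nearW.
Qed.

Lemma regular_at_cst X (x : X) c : regular_at x (fun=> c).
Proof.
by exists setT; split=> //; [exact: openT | apply: regular_cst; exact: openT].
Qed.

Lemma regular_atI X (x : X) f g : regular_at x f -> regular_at x g ->
  exists U, [/\ open U, U x, regular U f & regular U g].
Proof.
move=> [U [oU Ux rf]] [V [oV Vx rg]]; have oI := openI oU oV.
by exists (U `&` V); split=> //; [apply: (regular_sub oU)|apply: (regular_sub oV)].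
Qed.

Lemma regular_atD X (x : X) f g : regular_at x f -> regular_at x g ->
  regular_at x (fun y => f y + g y).
Proof.
move=> rf rg; have [U [oU Ux Uf Ug]] := regular_atI rf rg.
by exists U; split=> //; apply: regularD.
Qed.

Lemma regular_atM X (x : X) f g : regular_at x f -> regular_at x g ->
  regular_at x (fun y => f y * g y).
Proof.
move=> rf rg; have [U [oU Ux Uf Ug]] := regular_atI rf rg.
by exists U; split=> //; apply: regularM.
Qed.

Lemma regular_atN X (x : X) f : regular_at x f -> regular_at x (fun y => - f y).
Proof.
move=> rf; apply: regular_at_near (regular_atM (regular_at_cst x (-1)) rf).
by apply: nearW => y; rewrite mulN1r.
Qed.

Lemma regular_atB X (x : X) f g : regular_at x f -> regular_at x g ->
  regular_at x (fun y => f y - g y).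
Proof. by move=> rf rg; apply/regular_atD/regular_atN. Qed.

Lemma regular_at_sum X (x : X) (I : Type) (r : seq I) (F : I -> X -> K) :
  (forall i, regular_at x (F i)) -> regular_at x (fun y => \sum_(i <- r) F i y).
Proof.
move=> rF; elim: r => [|i r IH].
  apply: regular_at_near (regular_at_cst x 0); apply: nearW => y.
  by rewrite big_nil.
apply: regular_at_near (regular_atD (rF i) IH); apply: nearW => y.
by rewrite big_cons.
Qed.

Lemma regular_at_prod X (x : X) (I : Type) (r : seq I) (F : I -> X -> K) :
  (forall i, regular_at x (F i)) -> regular_at x (fun y => \prod_(i <- r) F i y).
Proof.
move=> rF; elim: r => [|i r IH].
  apply: regular_at_near (regular_at_cst x 1); apply: nearW => y.
  by rewrite big_nil.
apply: regular_at_near (regular_atM (rF i) IH); apply: nearW => y.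
by rewrite big_cons.
Qed.

Lemma regular_at_comp X Y (F : X -> Y) (x : X) f :
  kmorphism F -> regular_at (F x) f -> regular_at x (f \o F).
Proof.
move=> [cF rF] [U [oU Ux rf]]; exists (F @^-1` U); split=> //; last exact: rF.
by move/continuousP: cF; apply.
Qed.

Lemma kmorphismP X Y (F : X -> Y) :
  kmorphism F <-> continuous F /\
    forall x f, regular_at (F x) f -> regular_at x (f \o F).
Proof.
split=> [kF|[cF rF]].
  by split; [exact: kF.1 | move=> x f; apply: regular_at_comp].
split=> // V g oV rg; apply/regular_openP; first by move/continuousP: cF; apply.
by move=> x Vx; apply: rF; exists V.
Qed.

Lemma kmorphism_comp X Y (Z : kspace K) (F : X -> Y) (F' : Y -> Z) :
  kmorphism F -> kmorphism F' -> kmorphism (F' \o F).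
Proof.
move=> /kmorphismP[cF rF] /kmorphismP[cF' rF']; apply/kmorphismP.
by split=> [x|x f /rF' /rF //]; apply: continuous_comp; [apply: cF | apply: cF'].
Qed.

Lemma kmorphism_cst X Y (c : Y) : kmorphism (fun _ : X => c).
Proof.
apply/kmorphismP; split=> [x|x f _]; first exact: cst_continuous.
exact: regular_at_cst.
Qed.

Lemma kmorphism_id X : kmorphism (@id X).
Proof. by apply/kmorphismP; split=> // x; apply: cvg_id. Qed.

Lemma kspace_of_regular_at (X : topologicalType) (P : set X -> set (X -> K))
    (Pc : forall c, P setT (fun=> c)) PD PM (x : kspace_of Pc PD PM) f :
  regular_at x f <-> exists W g,
    [/\ open W, W x, P W g & \forall y \near x, f y = g y].
Proof.
split=> [[U [_ Ux rf]]|[W [g [oW Wx PWg fg]]]]; first exact: rf.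
apply: regular_at_near (_ : regular_at x g).
  by apply: filterS fg => y ->.
exists W; split=> // y Wy; exists W, g; split=> //; exact: nearW.
Qed.

Lemma set_val_continuous X (A : set X) : continuous (set_val : ksub A -> X).
Proof. exact: initial_continuous. Qed.

Lemma ksub_nbhsP X (A : set X) (z : ksub A) (N : set X) :
  nbhs (set_val z : X) N -> nbhs z (set_val @^-1` N).
Proof. exact: set_val_continuous. Qed.

Lemma ksub_regular_atP X (A : set X) (z : ksub A) f :
  regular_at z f <-> exists h, regular_at (set_val z : X) h /\
    \forall y \near z, f y = h (set_val y).
Proof.
rewrite kspace_of_regular_at; split=> [|[h [[U [oU Uz rh]] fh]]].
  move=> [W [g [oW Wz [U [h [oU rh gh]]] fg]]]; exists h; split.
    by exists U; split=> //; have [] := gh z Wz.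
  have : nbhs z W by apply: open_nbhs_nbhs.
  by apply: filterS2 fg => y -> /gh[].
exists (set_val @^-1` U), (h \o set_val); split=> //; first by exists U.
by exists U, h; split.
Qed.

Lemma set_val_kmorphism X (A : set X) : kmorphism (set_val : ksub A -> X).
Proof.
apply/kmorphismP; split; first exact: set_val_continuous.
move=> z f rf; apply/ksub_regular_atP; exists f; split=> //.
by apply: nbhsW => y.
Qed.

Lemma ksub_open_nbhs X (U : set X) (z : ksub U) (N : set X) : open U ->
  nbhs z (set_val @^-1` N) -> nbhs (set_val z : X) N.
Proof.
move=> oU; move=> /nbhs_openP[_ [[V oV <-] Vz VN]]; apply/nbhs_openP.
exists (V `&` U); split; [exact: openI | by split=> //; exact: set_valP |].
by move=> y [Vy Uy]; exact: (VN (exist _ y (mem_set Uy))).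
Qed.

Lemma ksub_open_regular X (U : set X) (z : ksub U) f : open U ->
  regular_at z (f \o set_val) -> regular_at (set_val z : X) f.
Proof.
move=> oU /ksub_regular_atP[h [rh fh]]; apply: regular_at_near rh.
by apply: ksub_open_nbhs => //; apply: filterS fh => y /= ->.
Qed.

Lemma kisomorphism_nbhs X Y (F : X -> Y) (x : X) (N : set Y) :
  kisomorphism F -> nbhs x (F @^-1` N) -> nbhs (F x) N.
Proof.
move=> [_ [G [[cG _] FK GK]]] nN.
have nG : nbhs (F x) (G @^-1` (F @^-1` N)).
  by apply: continuous_nbhs => //; rewrite FK.
by apply: filterS nG => y /=; rewrite GK.
Qed.

Lemma kisomorphism_regular X Y (F : X -> Y) (x : X) f :
  kisomorphism F -> regular_at x (f \o F) -> regular_at (F x) f.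
Proof.
move=> [_ [G [kG FK GK]]] rf.
have rG : regular_at (F x) ((f \o F) \o G) by apply: regular_at_comp => //; rewrite FK.
by apply: regular_at_near rG; apply: nearW => y /=; rewrite GK.
Qed.

End Germs.

(** * Affine charts *)

Section Charts.
Variable K : closedFieldType.
Implicit Types X : kspace K.

(** The isomorphism with a zero locus is recorded by its effects on points of [X]: principal open
    sets form a basis on [U], and germs are fractions of polynomials in [phi]. This dispenses with
    the subtypes [ksub U] afterwards. *)
Definition affine_chart X n (U : set X) (phi : X -> 'rV[K]_n) : Prop :=
  [/\ open U, exists S, phi @` U = zero_locus S,
    forall y N, U y -> nbhs y N <-> exists s, meval (phi y ord0) s != 0 /\
      forall y', U y' -> meval (phi y' ord0) s != 0 -> N y' &
    forall y f, U y -> regular_at y f <-> exists p q,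
      meval (phi y ord0) q != 0 /\
      \forall y' \near y, f y' = meval (phi y' ord0) p / meval (phi y' ord0) q].

Lemma affine_nbhsP n (z : affine_space K n) (N : set (affine_space K n)) :
  nbhs z N <-> exists s, meval (z ord0) s != 0 /\
    forall z' : affine_space K n, meval (z' ord0) s != 0 -> N z'.
Proof.
rewrite nbhs_openP; split=> [[_ [[S ->] Sz SN]]|[s [sz sN]]].
  have [s /not_implyP[Ss sz]] : exists s, ~ (S s -> meval (z ord0) s = 0).
    exact/existsNP.
  exists s; split=> [|z' sz']; first exact/eqP.
  by apply: SN => Sz'; rewrite (Sz' s Ss) eqxx in sz'.
exists (~` zero_locus [set s]); split; first by exists [set s].
  by move=> /(_ s erefl) s0; rewrite s0 eqxx in sz.
by move=> z' nz; apply: sN; apply: contra_notN nz => /eqP s0 _ ->.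
Qed.

Lemma affine_regular_atP n (z : affine_space K n) f :
  regular_at z f <-> exists p q, meval (z ord0) q != 0 /\
    \forall z' \near z, f z' = meval (z' ord0) p / meval (z' ord0) q.
Proof.
rewrite kspace_of_regular_at; split.
  move=> [W [g [oW Wz [p [q gE]]] fg]]; exists p, q; split.
    by have [] := gE z Wz.
  have nW : nbhs z W by apply: open_nbhs_nbhs.
  by apply: filterS2 fg nW => y -> /gE[].
move=> [p [q [qz fE]]].
have /nbhs_openP[W [oW Wz Wq]] : nbhs z [set z' : affine_space K n | meval (z' ord0) q != 0].
  by apply/affine_nbhsP; exists q.
exists W, (fun z' : affine_space K n => meval (z' ord0) p / meval (z' ord0) q); split=> //.
by exists p, q => y /Wq.
Qed.

Lemma ksub_affine_nbhsP n (Z : set (affine_space K n)) (z : ksub Z) N :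
  nbhs z N <-> exists s, meval (set_val z ord0) s != 0 /\
    forall z' : ksub Z, meval (set_val z' ord0) s != 0 -> N z'.
Proof.
split=> [/nbhs_openP[_ [[O oO <-] Oz ON]]|[s [sz sN]]].
  have /affine_nbhsP[s [sz sO]] : nbhs (set_val z : affine_space K n) O.
    exact: open_nbhs_nbhs.
  by exists s; split=> // z' /sO; apply: ON.
have : nbhs (set_val z) [set z' : affine_space K n | meval (z' ord0) s != 0].
  by apply/affine_nbhsP; exists s.
by move=> /ksub_nbhsP; apply: filterS.
Qed.

Lemma ksub_affine_regular_atP n (Z : set (affine_space K n)) (z : ksub Z) f :
  regular_at z f <-> exists p q, meval (set_val z ord0) q != 0 /\
    \forall z' \near z, f z' = meval (set_val z' ord0) p / meval (set_val z' ord0) q.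
Proof.
rewrite ksub_regular_atP; split=> [[h [/affine_regular_atP[p [q [qz hE]]] fh]]|].
  exists p, q; split=> //; move/ksub_nbhsP: hE.
  by apply: filterS2 fh => y ->.
move=> [p [q [qz fE]]].
exists (fun z' : affine_space K n => meval (z' ord0) p / meval (z' ord0) q); split=> //.
by apply/affine_regular_atP; exists p, q; split=> //; apply: nbhsW.
Qed.

Lemma variety_chart X (x : X) : variety X ->
  exists n U (phi : X -> 'rV[K]_n), U x /\ affine_chart U phi.
Proof.
move=> [[m [U [oU affU /(_ x)[i Uix]]]] _].
have [n [S [F isoF]]] := affU i; move: (oU i) => {}oU.
have [_ [G [[cG rG] FK GK]]] := isoF.
pose el y (Uy : U i y) : ksub (U i) := exist _ y (mem_set Uy).
(* The value 0 outside the chart only makes [phi] total. *)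
pose phi y : 'rV[K]_n := if pselect (U i y) is left Uy then set_val (F (el y Uy)) else 0.
have phiE (y : ksub (U i)) : phi (set_val y) = set_val (F y).
  rewrite /phi; case: pselect => [Uy|[]]; last exact: set_valP.
  by congr (set_val (F _)); apply: val_inj.
have phiG z : phi (set_val (G z)) = set_val z by rewrite phiE GK.
exists n, (U i), phi; split=> //.
have chN y N : U i y -> nbhs y N <-> exists s, meval (phi y ord0) s != 0 /\
      forall y', U i y' -> meval (phi y' ord0) s != 0 -> N y'.
  move=> Uy; split.
    move=> nN; have nN' : nbhs (el y Uy) (set_val @^-1` N) by apply: ksub_nbhsP.
    have /ksub_affine_nbhsP[s [sy sN]] :
        nbhs (F (el y Uy)) (G @^-1` (set_val @^-1` N)).
      by apply: kisomorphism_nbhs => //; apply: filterS nN' => w /=; rewrite FK.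
    exists s; rewrite -(phiE (el y Uy)) in sy; split=> // y' Uy' sy'.
    by have := sN (F (el y' Uy')); rewrite -phiE /= FK; apply.
  move=> [s [sy sN]]; apply: (@ksub_open_nbhs _ _ _ (el y Uy)) => //.
  have : nbhs (F (el y Uy)) [set z | meval ((set_val z : 'rV[K]_n) ord0) s != 0].
    by apply/ksub_affine_nbhsP; exists s; rewrite -phiE.
  move=> /(continuous_nbhs isoF.1.1); apply: filterS => w; rewrite /= -phiE; apply: sN.
  exact: set_valP.
split=> //.
  exists S; apply/seteqP; split=> [_ [y Uy <-]|z Sz].
    by rewrite (phiE (el y Uy)); exact: set_valP.
  have Sz' : z \in (zero_locus S : set (affine_space K n)) by exact: mem_set.
  exists (set_val (G (exist _ z Sz'))); first exact: set_valP.
  by rewrite phiG.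
move=> y f Uy; split=> [rf|[p [q [qy fE]]]].
  have /ksub_affine_regular_atP[p [q [qy fE]]] :
      regular_at (F (el y Uy)) (f \o set_val \o G).
    apply: kisomorphism_regular => //.
    have : regular_at (el y Uy) (f \o set_val).
      by apply: regular_at_comp => //; apply: set_val_kmorphism.
    by apply: regular_at_near; apply: nbhsW => w /=; rewrite FK.
  exists p, q; split; first by rewrite (phiE (el y Uy)).
  apply: (@ksub_open_nbhs _ _ _ (el y Uy)) => //.
  by move/(continuous_nbhs isoF.1.1): fE; apply: filterS => w /=; rewrite FK -phiE.
apply: (@ksub_open_regular _ _ _ (el y Uy)) => //.
have : regular_at (F (el y Uy)) (f \o set_val \o G).
  apply/ksub_affine_regular_atP; exists p, q; split; first by rewrite -phiE.
  apply: kisomorphism_nbhs => //.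
  have := @ksub_nbhsP _ _ _ (el y Uy) _ fE.
  by apply: filterS => w /=; rewrite FK -phiE.
move=> /(regular_at_comp isoF.1); apply: regular_at_near; apply: nbhsW => w /=.
by rewrite FK.
Qed.

Section ChartTheory.
Variables (X : kspace K) (n : nat) (U : set X) (phi : X -> 'rV[K]_n).
Hypothesis chartU : affine_chart U phi.

Lemma chart_open : open U. Proof. by case: chartU. Qed.

Lemma chart_nbhs y : U y -> nbhs y U.
Proof. by move=> Uy; apply: open_nbhs_nbhs; split=> //; exact: chart_open. Qed.

Lemma chart_polynomial_nbhs y p : U y -> meval (phi y ord0) p != 0 ->
  \forall y' \near y, meval (phi y' ord0) p != 0.
Proof.
case: chartU => _ _ chN _ Uy py.
have : nbhs y (U `&` [set y' | meval (phi y' ord0) p != 0]).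
  apply: filterI; first exact: chart_nbhs.
  by apply/chN => //; exists p.
by apply: filterS => y' [].
Qed.

Lemma chart_polynomial_regular y p : U y -> regular_at y (fun y' => meval (phi y' ord0) p).
Proof.
case: chartU => _ _ _ chR Uy; apply/chR => //; exists p, 1.
by rewrite meval1 oner_neq0; split=> //; apply: nbhsW => y'; rewrite meval1 divr1.
Qed.

End ChartTheory.

(** The axioms of a [kspace] provide no inverses; in an affine chart [f] is a fraction p/q, and its
    inverse is q/p. *)
Lemma regular_at_inv X (x : X) f : variety X -> regular_at x f -> f x != 0 ->
  regular_at x (fun y => (f y)^-1) /\ \forall y \near x, f y != 0.
Proof.
move=> vX rf fx; have [n [U [phi [Ux chU]]]] := variety_chart x vX.
have [_ _ chN chR] := chU.
have /chR -/(_ Ux)[p [q [qx fE]]] := rf.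
have px : meval (phi x ord0) p != 0.
  move: fx; have -> := nbhs_singleton fE.
  by apply: contraNneq => ->; rewrite mul0r.
split.
  apply/chR => //; exists q, p; split=> //.
  by apply: filterS fE => y ->; rewrite invf_div.
have nq := chart_polynomial_nbhs chU Ux qx.
have np := chart_polynomial_nbhs chU Ux px.
by apply: filterS3 fE np nq => y -> p0 q0; rewrite mulf_neq0 ?invr_eq0.
Qed.

(** The [q i] generate the ideal of polynomials vanishing on [A] throughout the chart. They also
    generate the ideal of germs, because a numerator vanishing on [A] only near [x] vanishes on all
    of [A] in the chart after multiplication by a suitable polynomial that is nonzero at [x]. *)
Lemma vanishing_germs_generated X (x : X) (A : set X) : variety X -> closed A ->
  exists r (q : 'I_r -> X -> K), [/\ forall i, regular_at x (q i),
    forall i, \forall y \near x, A y -> q i y = 0,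
    \forall y \near x, (forall i, q i y = 0) -> A y &
    forall f, regular_at x f -> (\forall y \near x, A y -> f y = 0) ->
      exists c : 'I_r -> X -> K, (forall i, regular_at x (c i)) /\
        \forall y \near x, f y = \sum_i c i y * q i y].
Proof.
move=> vX cA; have [n [U [phi [Ux chU]]]] := variety_chart x vX.
have [_ _ chN chR] := chU.
pose I := [set p | forall y, U y -> A y -> meval (phi y ord0) p = 0].
have idI : ideal I.
  split=> [y _ _|p q Ip Iq y Uy Ay|p q Iq y Uy Ay]; first exact: meval0.
  - by rewrite mevalD Ip ?Iq ?addr0.
  - by rewrite mevalM Iq ?mulr0.
have [r [q [Iq genI]]] := hilbert_basis idI.
have nU := chart_nbhs chU Ux.
have genE p : I p -> exists c : 'I_r -> {mpoly K[n]}, forall y,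
    meval (phi y ord0) p = \sum_i meval (phi y ord0) (c i) * meval (phi y ord0) (q i).
  move=> /genI[c ->]; exists c => y; rewrite raddf_sum /=.
  by apply: eq_bigr => i _; rewrite mevalM.
exists r, (fun i y => meval (phi y ord0) (q i)); split.
- by move=> i; apply: (chart_polynomial_regular chU).
- by move=> i; apply: filterS nU => y Uy Ay; apply: Iq.
- apply: filterS nU => y Uy q0; apply: contrapT => nA.
  have : nbhs y (~` A).
    by apply: open_nbhs_nbhs; split=> //; rewrite openC.
  move=> /chN -/(_ Uy)[s [sy sA]].
  have /genE[c cE] : I s.
    move=> y' Uy' Ay'; apply/eqP; apply: contrapT => /negP s0.
    exact: (sA y' Uy' s0).
  by move: sy; rewrite cE big1 ?eqxx // => i _; rewrite q0 mulr0.
move=> f /chR -/(_ Ux)[p [q' [q'x fE]]] fA.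
have [s [sx sP]] := (chN _ _ Ux).1 (filterI (filterI fE fA)
  (chart_polynomial_nbhs chU Ux q'x)).
have /genE[c cE] : I (p * s).
  move=> y Uy Ay; rewrite mevalM; apply/eqP; rewrite mulf_eq0.
  have [_|s0] := eqVneq (meval (phi y ord0) s) 0; first by rewrite orbT.
  have [[/= fy /(_ Ay) fy0] q'0] := sP y Uy s0.
  by move/eqP: fy; rewrite fy0 eq_sym mulf_eq0 invr_eq0 (negbTE q'0) !orbF.
exists (fun i y => meval (phi y ord0) (c i) / (meval (phi y ord0) s * meval (phi y ord0) q')).
split=> [i|].
  apply/chR => //; exists (c i), (s * q'); rewrite mevalM mulf_neq0 //; split=> //.
  by apply: nbhsW => y; rewrite mevalM.
have ns := chart_polynomial_nbhs chU Ux sx.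
have nq' := chart_polynomial_nbhs chU Ux q'x.
apply: filterS3 fE ns nq' => y -> s0 q'0.
under eq_bigr do rewrite mulrAC; rewrite -mulr_suml -cE mevalM.
by rewrite invfM mulrA mulfK.
Qed.

(* A minimal closed subset contained in no [F i] is irreducible, and
   [generic_point] then gives a point of it lying outside of every [F i]. *)
Lemma closed_cover_stationary X (x : X) (F : nat -> set X) :
  ~ countable [set: K] -> variety X -> (forall i, closed (F i)) ->
  (forall i j, (i <= j)%N -> F i `<=` F j) -> (forall y, exists i, F i y) ->
  exists i, nbhs x (F i).
Proof.
move=> uK vX cF monoF coverF; have [n [U [phi [Ux chU]]]] := variety_chart x vX.
have [_ [S US] chN _] := chU.
apply: contrapT => /forallNP noF.
pose van Y := [set p | forall y : X, Y y -> meval (phi y ord0) p = 0].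
have idvan Y : ideal (van Y).
  split=> [y _|p q Yp Yq y Yy|p q Yq y Yy]; first exact: meval0.
  - by rewrite mevalD Yp ?Yq ?addr0.
  - by rewrite mevalM Yq ?mulr0.
(* Minimal sets are found through maximal vanishing ideals; [U] itself is bad since no [F i] is a
   neighbourhood of [x]. *)
pose bad (Y : set X) := exists T, Y = U `&` [set y | zero_locus T (phi y)] /\
  forall i, ~ (Y `<=` F i).
have [|_ [Y [T [YE Ybad]] <-]|A [[Y [T [YE Ybad]] <-] Ymax]] :=
    @noetherian_max _ n [set van Y | Y in bad].
- exists (van U), U => //; exists S; split.
    apply/seteqP; split=> y; last by case.
    by move=> Uy; split=> //=; rewrite -US; exists y.
  by move=> i UF; apply: (noF i); apply: filterS UF _; apply: chart_nbhs chU _ Ux.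
- exact: idvan.
(* By maximality, a polynomial not identically zero on [Y] cuts out a set that is no longer bad. As
   [F] increases, two such sets lie in a common [F i], which makes [van Y] prime. *)
have good p : ~ van Y p -> exists i, Y `&` [set y | meval (phi y ord0) p = 0] `<=` F i.
  move=> Yp; apply: contrapT => /forallNP bad'.
  apply: Yp; apply: (Ymax (van (Y `&` [set y | meval (phi y ord0) p = 0]))).
  - by move=> q Yq y [/Yq].
  - exists (Y `&` [set y | meval (phi y ord0) p = 0]) => //.
    exists (T `|` [set p]); split=> //; rewrite YE; apply/seteqP; split=> y.
      by move=> [[Uy Ty] py]; split=> // q [/Ty //|->].
    move=> [Uy Ty]; split; last by apply: Ty; right.
    by split=> // q Tq; apply: Ty; left.
  - by move=> y [].
have prime p q : ~ van Y p -> ~ van Y q -> ~ van Y (p * q).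
  move=> /good[i Fi] /good[j Fj] Ypq; apply: (Ybad (maxn i j)) => y Yy.
  have /eqP := Ypq y Yy; rewrite mevalM mulf_eq0 => /orP[]/eqP y0.
    by apply: (monoF i); [exact: leq_maxl | apply: Fi].
  by apply: (monoF j); [exact: leq_maxr | apply: Fj].
(* A point of [Y] where none of these [f i] vanishes lies in no [F i]. *)
have /choice[f fP] i : exists p, ~ van Y p /\ forall y, Y y -> F i y -> meval (phi y ord0) p = 0.
  have [y /not_implyP[Yy Fy]] : exists y, ~ (Y y -> F i y).
    exact/existsNP/Ybad.
  have Uy : U y by move: Yy; rewrite YE => -[].
  have : nbhs y (~` F i).
    by apply: open_nbhs_nbhs; split=> //; rewrite openC.
  move=> /chN -/(_ Uy)[s [sy sF]]; exists s; split.
    by move=> /(_ y Yy) s0; rewrite s0 eqxx in sy.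
  move=> y' Yy' Fy'; apply/eqP; apply: contrapT => /negP s0.
  by apply: (sF y' _ s0) => //; move: Yy'; rewrite YE => -[].
have [s|c [cY cf]] := @generic_point K n (van Y) f uK (idvan Y).
  elim: s => [|i s IH]; last by rewrite big_cons; apply: prime => //; case: (fP i).
  rewrite big_nil => Y1; apply: (Ybad 0%N) => y /Y1.
  by rewrite meval1 => /eqP; rewrite oner_eq0.
have cT p : T p -> meval (c ord0) p = 0.
  by move=> Tp; apply: cY => y; rewrite YE => -[_ /(_ p Tp)].
have [y Uy yc] : (phi @` U) c.
  rewrite US => p Sp; apply: cY => y; rewrite YE => -[Uy _].
  have : zero_locus S (phi y) by rewrite -US; exists y.
  by apply.
have Yy : Y y by rewrite YE; split=> //= p Tp; rewrite yc; apply: cT.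
have [i Fi] := coverF y; have [_ fi] := fP i.
by have := cf i; rewrite -yc fi ?eqxx.
Qed.

End Charts.

(** * Products *)

Section Products.
Variable K : closedFieldType.
Implicit Types X Y Z : kspace K.

Lemma kprod_basicT Y Z : @kprod_basic K Y Z setT.
Proof.
exists setT, setT, (fun=> 1); split; [exact: openT|exact: openT|exact: tensor_cst|].
by rewrite setXTT setTI; apply/seteqP; split=> // p _; exact: oner_neq0.
Qed.

Lemma kprod_basicI Y Z (W W' : set (Y * Z)) :
  kprod_basic W -> kprod_basic W' -> kprod_basic (W `&` W').
Proof.
move=> [U [V [h [oU oV th ->]]]] [U' [V' [h' [oU' oV' th' ->]]]].
exists (U `&` U'), (V `&` V'), (fun p => h p * h' p).
split; [exact: openI|exact: openI|exact: tensorM|].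
apply/seteqP; split=> p /=; rewrite mulf_eq0 negb_or.
  by move=> [[[? ?] ->] [[? ?] ->]].
by move=> [[[? ?] [? ?]] /andP[]].
Qed.

Lemma kprod_nbhsP Y Z (p : kprod Y Z) (N : set (kprod Y Z)) :
  nbhs p N <-> exists B : set (kprod Y Z), [/\ kprod_basic B, B p & B `<=` N].
Proof.
rewrite nbhs_openP; split=> [[_ [[D DB <-] [B DB' Bp] DN]]|[B [bB Bp BN]]].
  exists B; split=> //; last by move=> q Bq; apply: DN; exists B.
  have [F FB <-] := DB _ DB'.
  rewrite bigcap_fset big_seq; apply: big_ind => [|W W'|W /FB].
  - exact: kprod_basicT.
  - exact: kprod_basicI.
  - by rewrite inE.
exists B; split=> //; exists [set B]; last by rewrite bigcup_set1.
by move=> _ ->; exact: finI_from1.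
Qed.

Lemma tensor_pullback X Y Z (P : X -> Y) (Q : X -> Z) (x : X) U V h :
  kmorphism P -> kmorphism Q -> open U -> open V -> U (P x) -> V (Q x) ->
  tensor U V h -> regular_at x (fun y => h (P y, Q y)).
Proof.
move=> kP kQ oU oV Ux Vx [I [a [b [ra rb hE]]]].
have rx i : regular_at x (fun y => a i (P y) * b i (Q y)).
  apply: regular_atM.
    by apply: (regular_at_comp kP); exists U.
  by apply: (regular_at_comp kQ); exists V.
apply: regular_at_near (regular_at_sum (index_enum I) rx).
have nU : nbhs x (P @^-1` U).
  by apply: continuous_nbhs kP.1 _; apply: open_nbhs_nbhs.
have nV : nbhs x (Q @^-1` V).
  by apply: continuous_nbhs kQ.1 _; apply: open_nbhs_nbhs.
by apply: filterS2 nU nV => y Uy Vy; rewrite hE.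
Qed.

(* Multiplying numerator and denominator by the equation of a basic
   neighbourhood of p makes [f q * h q = a q] valid on the whole of U x V. *)
Lemma kprod_regular_at Y Z (p : kprod Y Z) f : regular_at p f ->
  exists U V (a h : Y * Z -> K), [/\ open U, open V, tensor U V a, tensor U V h &
    [/\ U p.1, V p.2, h p != 0 &
      forall q, U q.1 -> V q.2 -> f q * h q = a q]].
Proof.
move=> /kspace_of_regular_at[W [g [oW Wp [U [V [a [h [oU oV ta th gE]]]]] fg]]].
have /kprod_nbhsP[_ [[U' [V' [h' [oU' oV' th' ->]]]] [[U'p V'p] h'p] BN]] :
    nbhs p (W `&` [set q | f q = g q]).
  by apply: filterI fg; apply: open_nbhs_nbhs.
have [Up Vp hp _] := gE p Wp.
exists (U `&` U'), (V `&` V'), (fun q => a q * h' q), (fun q => h q * h' q).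
split; [exact: openI|exact: openI|exact: tensorM|exact: tensorM|].
split=> //; first by rewrite mulf_neq0.
move=> q [Uq U'q] [Vq V'q].
have [->|h'q] := eqVneq (h' q) 0; first by rewrite !mulr0.
have [Wq /= ->] := BN q (conj (conj U'q V'q) h'q).
by have [_ _ hq ->] := gE q Wq; rewrite mulrA divfK.
Qed.

(** The universal property of the product; [variety X] serves to invert the pulled-back
    denominators. *)
Lemma pair_kmorphism X Y Z (P : X -> Y) (Q : X -> Z) : variety X ->
  kmorphism P -> kmorphism Q -> kmorphism (fun x => (P x, Q x) : kprod Y Z).
Proof.
move=> vX kP kQ; apply/kmorphismP; split=> x.
  move=> N /kprod_nbhsP[_ [[U [V [h [oU oV th ->]]]] [[/= Ux Vx] hx] BN]].
  have rh := tensor_pullback kP kQ oU oV Ux Vx th.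
  have [_ nh] := regular_at_inv vX rh hx.
  have nU : nbhs x (P @^-1` U).
    by apply: continuous_nbhs kP.1 _; apply: open_nbhs_nbhs.
  have nV : nbhs x (Q @^-1` V).
    by apply: continuous_nbhs kQ.1 _; apply: open_nbhs_nbhs.
  apply: filterS3 nU nV nh => y Uy Vy hy; exact: BN.
move=> f /kprod_regular_at[U [V [a [h [oU oV ta th [Ux Vx hx fE]]]]]].
have ra := tensor_pullback kP kQ oU oV Ux Vx ta.
have rh := tensor_pullback kP kQ oU oV Ux Vx th.
have [rhV nh] := regular_at_inv vX rh hx.
apply: regular_at_near (regular_atM ra rhV).
have nU : nbhs x (P @^-1` U).
  by apply: continuous_nbhs kP.1 _; apply: open_nbhs_nbhs.
have nV : nbhs x (Q @^-1` V).
  by apply: continuous_nbhs kQ.1 _; apply: open_nbhs_nbhs.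
by apply: filterS3 nU nV nh => y Uy Vy hy; rewrite -fE // mulfK.
Qed.

(** The tensor square of the local ring at [x0], seen as functions near (x0, x0). Germs of the
    product variety at that point are fractions of such functions. *)
Definition bigerm X (x0 : X) (h : X -> X -> K) : Prop :=
  exists (I : finType) (a b : I -> X -> K) (N : set X),
    [/\ forall i, regular_at x0 (a i), forall i, regular_at x0 (b i), nbhs x0 N &
    forall x y, N x -> N y -> h x y = \sum_i a i x * b i y].

Section Bigerms.
Variables (X : kspace K) (x0 : X).

Lemma bigermB (g h : X -> X -> K) : bigerm x0 g -> bigerm x0 h ->
  bigerm x0 (fun x y => g x y - h x y).
Proof.
move=> [I [a [b [N [ra rb nN gE]]]]] [I' [a' [b' [N' [ra' rb' nN' hE]]]]].
exists (I + I')%type, (fun i => match i with inl i => a i | inr i => fun x => - a' i x end),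
  (fun i => match i with inl i => b i | inr i => b' i end), (N `&` N').
split=> [[]i //|[]i //||x y [Nx N'x] [Ny N'y]]; first exact: regular_atN.
  exact: filterI.
rewrite big_sumType gE ?hE // -sumrN /=; congr (_ + _).
by apply: eq_bigr => i _; rewrite mulNr.
Qed.

Lemma bigermM (g h : X -> X -> K) : bigerm x0 g -> bigerm x0 h ->
  bigerm x0 (fun x y => g x y * h x y).
Proof.
move=> [I [a [b [N [ra rb nN gE]]]]] [I' [a' [b' [N' [ra' rb' nN' hE]]]]].
exists (I * I')%type, (fun i x => a i.1 x * a' i.2 x), (fun i y => b i.1 y * b' i.2 y),
  (N `&` N').
split=> [i|i||x y [Nx N'x] [Ny N'y]]; [exact: regular_atM|exact: regular_atM|exact: filterI|].
rewrite gE ?hE // big_distrlr /= pair_big /=.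
by apply: eq_bigr => i _; rewrite mulrACA.
Qed.

Lemma bigerm_prod f g : regular_at x0 f -> regular_at x0 g ->
  bigerm x0 (fun x y => f x * g y).
Proof.
move=> rf rg; exists unit, (fun=> f), (fun=> g), setT; split=> //; first exact: filterT.
by move=> x y _ _; rewrite big_const card_unit /= addr0.
Qed.

Lemma bigerm_left h : bigerm x0 h -> regular_at x0 (h^~ x0).
Proof.
move=> [I [a [b [N [ra rb nN hE]]]]]; have Nx0 := nbhs_singleton nN.
have rx i : regular_at x0 (fun x => a i x * b i x0).
  by apply: regular_atM => //; apply: regular_at_cst.
apply: regular_at_near (regular_at_sum (index_enum I) rx).
by apply: filterS nN => y Ny; rewrite hE.
Qed.

Lemma bigerm_diag h : bigerm x0 h -> regular_at x0 (fun x => h x x).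
Proof.
move=> [I [a [b [N [ra rb nN hE]]]]]; have Nx0 := nbhs_singleton nN.
have rx i : regular_at x0 (fun x => a i x * b i x) by apply: regular_atM.
apply: regular_at_near (regular_at_sum (index_enum I) rx).
by apply: filterS nN => y Ny; rewrite hE.
Qed.

End Bigerms.

Lemma bigerm_pullback X Y Z (W : kspace K) (P : X -> Y) (Q : X -> Z) (M : kprod Y Z -> W)
    (x0 : X) f : kmorphism P -> kmorphism Q -> kmorphism M ->
  regular_at (M (P x0, Q x0)) f ->
  exists a h N, [/\ bigerm x0 a, bigerm x0 h, h x0 x0 != 0, nbhs x0 N &
    forall x y, N x -> N y -> f (M (P x, Q y)) * h x y = a x y].
Proof.
move=> kP kQ kM /(regular_at_comp kM)/kprod_regular_at.
move=> [U [V [a [h [oU oV ta th [Ux Vx hx fE]]]]]].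
have nU : nbhs x0 (P @^-1` U).
  by apply: continuous_nbhs kP.1 _; apply: open_nbhs_nbhs.
have nV : nbhs x0 (Q @^-1` V).
  by apply: continuous_nbhs kQ.1 _; apply: open_nbhs_nbhs.
have pull t : tensor U V t -> bigerm x0 (fun x y => t (P x, Q y)).
  move=> [I [c [d [rc rd tE]]]].
  exists I, (fun i => c i \o P), (fun i => d i \o Q), (P @^-1` U `&` Q @^-1` V).
  split=> [i|i||x y [Ux' _] [_ Vy]]; last exact: tE.
  - by apply: regular_at_comp => //; exists U.
  - by apply: regular_at_comp => //; exists V.
  - exact: filterI.
exists (fun x y => a (P x, Q y)), (fun x y => h (P x, Q y)).
exists (P @^-1` U `&` Q @^-1` V); split=> //; [exact: pull|exact: pull|exact: filterI|].
by move=> x y [Ux' _] [_ Vy]; apply: fE.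
Qed.

End Products.

(** * Nakayama's lemma *)

Section Nakayama.
Variables (K : closedFieldType) (X : kspace K) (x0 : X) (A : set X).
Variables (r : nat) (q : 'I_r -> X -> K).
Hypothesis vX : variety X.
Hypothesis q_generate : forall f, regular_at x0 f ->
  (\forall y \near x0, A y -> f y = 0) ->
  exists c : 'I_r -> X -> K, (forall i, regular_at x0 (c i)) /\
    \forall y \near x0, f y = \sum_i c i y * q i y.

(* The product of the maximal ideal at x0 and the ideal generated by the germs
   of the [q i]; the latter are all the germs vanishing on A. *)
Definition max_mul (f : X -> K) : Prop :=
  exists m : 'I_r -> X -> K, [/\ forall i, regular_at x0 (m i),
    forall i, m i x0 = 0 & \forall y \near x0, f y = \sum_i m i y * q i y].

Lemma max_mul_near f g : (\forall y \near x0, f y = g y) -> max_mul f -> max_mul g.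
Proof.
move=> fg [m [rm m0 fE]]; exists m; split=> //.
by apply: filterS2 fg fE => y ->.
Qed.

Lemma max_mul0 : max_mul (fun=> 0).
Proof.
exists (fun _ _ => 0); split=> //; first by move=> i; apply: regular_at_cst.
by apply: nbhsW => y; rewrite big1 // => i _; rewrite mul0r.
Qed.

Lemma max_mulD f g : max_mul f -> max_mul g -> max_mul (fun y => f y + g y).
Proof.
move=> [m [rm m0 fE]] [m' [rm' m'0 gE]].
exists (fun i y => m i y + m' i y); split=> [i|i|]; first exact: regular_atD.
  by rewrite m0 m'0 addr0.
apply: filterS2 fE gE => y -> ->; rewrite -big_split /=.
by apply: eq_bigr => i _; rewrite mulrDl.
Qed.

Lemma max_mulZ f g : regular_at x0 f -> max_mul g -> max_mul (fun y => f y * g y).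
Proof.
move=> rf [m [rm m0 gE]].
exists (fun i y => f y * m i y); split=> [i|i|]; first exact: regular_atM.
  by rewrite m0 mulr0.
apply: filterS gE => y ->; rewrite mulr_sumr.
by apply: eq_bigr => i _; rewrite mulrA.
Qed.

Lemma max_mulM f g : regular_at x0 f -> f x0 = 0 -> regular_at x0 g ->
  (\forall y \near x0, A y -> g y = 0) -> max_mul (fun y => f y * g y).
Proof.
move=> rf f0 rg /(q_generate rg)[c [rc gE]].
exists (fun i y => f y * c i y); split=> [i|i|]; first exact: regular_atM.
  by rewrite f0 mul0r.
apply: filterS gE => y ->; rewrite mulr_sumr.
by apply: eq_bigr => i _; rewrite mulrA.
Qed.

(* Induction on the length of the sum: either the first left factor vanishes on
   A, or its value at a point of A expresses the first right factor, modulo a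
   function vanishing on A, by the other ones. *)
Lemma max_mul_sum n (a b : 'I_n -> X -> K) (N : set X) :
  (forall i, regular_at x0 (a i)) -> (forall i, regular_at x0 (b i)) ->
  (forall i, a i x0 = 0) -> (forall i, b i x0 = 0) -> nbhs x0 N ->
  (forall x y, N x -> N y -> A x -> A y -> \sum_i a i x * b i y = 0) ->
  max_mul (fun x => \sum_i a i x * b i x).
Proof.
elim: n a b => [|n IH] a b ra rb a0 b0 nN ab0.
  by apply: max_mul_near max_mul0; apply: nbhsW => y; rewrite big_ord0.
have [aA|] := pselect (forall x, N x -> A x -> a ord0 x = 0).
  have mab : max_mul (fun x => b ord0 x * a ord0 x).
    by apply: max_mulM => //; apply: filterS nN.
  have mS : max_mul (fun x => \sum_i a (lift ord0 i) x * b (lift ord0 i) x).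
    apply: IH nN _ => // x y Nx Ny Ax Ay.
    by have := ab0 x y Nx Ny Ax Ay; rewrite big_ord_recl aA // mul0r add0r.
  apply: max_mul_near (max_mulD mab mS); apply: nbhsW => y.
  by rewrite big_ord_recl mulrC.
move=> /existsNP[u /not_implyP[Nu /not_implyP[Au /eqP au]]].
pose c i := a (lift ord0 i) u / a ord0 u.
pose b' y := b ord0 y + \sum_i c i * b (lift ord0 i) y.
have b'A y : N y -> A y -> b' y = 0.
  move=> Ny Ay; apply: (mulfI au); rewrite mulr0 -(ab0 u y Nu Ny Au Ay) big_ord_recl.
  rewrite mulrDr mulr_sumr; congr (_ + _); apply: eq_bigr => i _.
  by rewrite mulrA /c mulrCA divff // mulr1.
have rb' : regular_at x0 b'.
  apply: regular_atD => //; apply: regular_at_sum => i.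
  by apply: regular_atM => //; apply: regular_at_cst.
have mab : max_mul (fun x => a ord0 x * b' x).
  by apply: max_mulM => //; apply: filterS nN.
pose a' i x := a (lift ord0 i) x - a ord0 x * c i.
have sumE x y : \sum_i a i x * b i y = a ord0 x * b' y + \sum_i a' i x * b (lift ord0 i) y.
  rewrite big_ord_recl /b' mulrDr -addrA; congr (_ + _).
  rewrite mulr_sumr -big_split /=; apply: eq_bigr => i _; rewrite /a'; ring.
have mS : max_mul (fun x => \sum_i a' i x * b (lift ord0 i) x).
  apply: IH nN _ => // [i|i|x y Nx Ny Ax Ay].
  - apply: regular_atB => //; apply: regular_atM => //; exact: regular_at_cst.
  - by rewrite /a' !a0 mul0r subrr.
  - by have := ab0 x y Nx Ny Ax Ay; rewrite sumE b'A // mulr0 add0r.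
by apply: max_mul_near (max_mulD mab mS); apply: nbhsW => y; rewrite sumE.
Qed.

(** Subtracting from each factor its value at [x0] changes [T] only by its values on the axes, which
    are zero. Hence all factors may be taken in the maximal ideal, as [max_mul_sum] requires. *)
Lemma max_mul_bigerm (T : X -> X -> K) (N : set X) : bigerm x0 T -> nbhs x0 N ->
  (forall x, N x -> T x x0 = 0) -> (forall x, N x -> T x0 x = 0) ->
  (forall x y, N x -> N y -> A x -> A y -> T x y = 0) ->
  max_mul (fun x => T x x).
Proof.
move=> [I [a [b [N' [ra rb nN' TE]]]]] nN T0 T0' TA.
have nI : nbhs x0 (N `&` N') by exact: filterI.
have [Nx0 N'x0] := nbhs_singleton nI.
pose a' i x := a i x - a i x0; pose b' i x := b i x - b i x0.
have TE' x y : N x -> N' x -> N y -> N' y -> T x y = \sum_(i < #|I|)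
    a' (enum_val i) x * b' (enum_val i) y.
  move=> Nx N'x Ny N'y; rewrite -(big_enum_val (A := I) (fun i => a' i x * b' i y)) /=.
  transitivity (T x y - T x x0 - (T x0 y - T x0 x0)).
    by rewrite T0 // T0' // T0 // !subr0.
  rewrite !TE // -!sumrB; apply: eq_big => // i _; rewrite /a' /b'; ring.
apply: max_mul_near (_ : max_mul (fun x => \sum_(i < #|I|)
    a' (enum_val i) x * b' (enum_val i) x)).
  by apply: filterS nI => x [Nx N'x]; rewrite TE'.
apply: max_mul_sum nI _ => [i|i|i|i|x y [Nx N'x] [Ny N'y] Ax Ay].
- by apply: regular_atB => //; apply: regular_at_cst.
- by apply: regular_atB => //; apply: regular_at_cst.
- exact: subrr.
- exact: subrr.
- by rewrite -TE' //; apply: TA.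
Qed.

Lemma det_regular_at n (M : X -> 'M[K]_n) :
  (forall i j, regular_at x0 (fun x => M x i j)) -> regular_at x0 (fun x => \det (M x)).
Proof.
move=> rM; apply: regular_at_sum => s; apply: regular_atM.
  exact: regular_at_cst.
by apply: regular_at_prod => i; apply: rM.
Qed.

(** The determinant trick: the matrix [c%:M] plus the [m i j] has determinant c^r at [x0], so it is
    invertible nearby, and at points of [S] it kills the vector of the [q i]. The argument is
    pointwise, which allows relations holding on [S] only. *)
Lemma nakayama (S : set X) (c : K) : c != 0 ->
  (forall i, exists g, max_mul g /\
    \forall x \near x0, S x -> c * q i x + g x = 0) ->
  \forall x \near x0, S x -> forall i, q i x = 0.
Proof.
move=> c0 qS.
have /choice[m mP] i : exists m : 'I_r -> X -> K, [/\ forall j, regular_at x0 (m j),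
    forall j, m j x0 = 0 &
    \forall x \near x0, S x -> c * q i x + \sum_j m j x * q j x = 0].
  have [g [[m [rm m0 gE]] gS]] := qS i; exists m; split=> //.
  by apply: filterS2 gE gS => x ->.
pose M x := c%:M + \matrix_(i, j) m i j x.
have rM : regular_at x0 (fun x => \det (M x)).
  apply: det_regular_at => i j; have [rm _ _] := mP i.
  apply: regular_at_near (regular_atD (regular_at_cst x0 (c *+ (i == j))) (rm j)).
  by apply: nbhsW => x; rewrite !mxE.
have M0 : \det (M x0) != 0.
  have -> : M x0 = c%:M.
    by apply/matrixP => i j; have [_ m0 _] := mP i; rewrite !mxE m0 addr0.
  by rewrite det_scalar expf_neq0.
have [_ nM] := regular_at_inv vX rM M0.
have nS : \forall x \near x0, forall i, S x -> c * q i x + \sum_j m i j x * q j x = 0.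
  by apply: filter_forall => i; case: (mP i).
apply: filterS2 nM nS => x Mx qx Sx i.
have : M x *m \col_i q i x = 0.
  apply/colP => k; rewrite [RHS]mxE; apply: etrans (qx k Sx).
  rewrite mulmxDl mul_scalar_mx !mxE.
  by congr (_ + _); apply: eq_bigr => j _; rewrite !mxE.
have uM : M x \in unitmx by rewrite unitmxE unitfE.
move=> /(congr1 (mulmx (invmx (M x)))); rewrite mulKmx // mulmx0.
by move=> /colP/(_ i); rewrite !mxE.
Qed.

End Nakayama.

(** * Ind-groups *)

Section Embeddings.
Variable K : closedFieldType.
Implicit Types X Y Z : kspace K.

(** What a closed embedding gives on neighbourhoods and germs, in a form that composes directly
    along a filtration. *)
Definition kembedding X Y (t : X -> Y) : Prop :=
  [/\ kmorphism t,
    forall x N, nbhs x N -> exists N', nbhs (t x) N' /\ t @^-1` N' `<=` N &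
    forall x f, regular_at x f ->
      exists h, regular_at (t x) h /\ \forall y \near x, f y = h (t y)].

Lemma kembedding_id X : kembedding (@id X).
Proof.
split=> [|x N nN|x f rf]; [exact: kmorphism_id|by exists N; split|].
by exists f; split=> //; apply: nbhsW.
Qed.

Lemma kembedding_comp X Y Z (t : X -> Y) (u : Y -> Z) :
  kembedding t -> kembedding u -> kembedding (u \o t).
Proof.
move=> [kt tN tR] [ku uN uR]; split; first exact: kmorphism_comp.
  move=> x N /tN[N' [/uN[N'' [nN'' uN'']] tN']]; exists N''; split=> // y Ny.
  exact/tN'/uN''.
move=> x f /tR[h [/uR[g [rg gE]] hE]]; exists g; split=> //.
by move/(continuous_nbhs kt.1): gE; apply: filterS2 hE => y -> /= ->.
Qed.

Lemma closed_embedding_kembedding X Y (t : X -> Y) :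
  closed_embedding t -> kembedding t.
Proof.
move=> [Z [_ [g [isoG tE]]]]; have [kg [g' [kg' gK g'K]]] := isoG.
have -> : t = set_val \o g by apply/funext => x; rewrite /= tE.
split; first exact: kmorphism_comp kg (@set_val_kmorphism K Y Z).
  move=> x N nN; have : nbhs (g x) (g' @^-1` N).
    by apply: continuous_nbhs kg'.1 _; rewrite gK.
  move=> /nbhs_openP[_ [[O oO <-] Ox ON]]; exists O.
  split=> [|y Oy]; first exact: open_nbhs_nbhs.
  by have := ON (g y) Oy; rewrite /= gK.
move=> x f rf; have : regular_at (g x) (f \o g').
  by apply: regular_at_comp kg' _; rewrite gK.
move=> /ksub_regular_atP[h [rh fh]]; exists h; split=> //.
by move/(continuous_nbhs kg.1): fh; apply: filterS => y /=; rewrite gK.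
Qed.

End Embeddings.

Section IndGroup.
Variables (K : closedFieldType) (G : groupType) (V : filtration K G).
Hypothesis indG : ind_group V.

Local Notation inc k := (@inc K G V k).

Lemma ind_piece_variety k : variety (piece V k).
Proof. by case: indG => -[]. Qed.

Lemma ind_inc_inj k : injective (inc k).
Proof. by case: indG => -[_ + _ _] _; apply. Qed.

Lemma transition k l : (k <= l)%N ->
  exists t : piece V k -> piece V l, kembedding t /\ forall y, inc l (t y) = inc k y.
Proof.
elim: l => [|l IH].
  by rewrite leqn0 => /eqP ->; exists id; split=> //; apply: kembedding_id.
rewrite leq_eqVlt => /predU1P[->|]; first by exists id; split=> //; apply: kembedding_id.
rewrite ltnS => /IH[t [kt tE]].
have [[_ _ _ /(_ l)[u [/closed_embedding_kembedding ku uE]]] _] := indG.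
exists (u \o t); split=> [|y]; first exact: kembedding_comp.
by rewrite /= uE tE.
Qed.

(** Allowing every sufficiently large target piece lets several morphisms share one. *)
Lemma ind_morphism_level (f : G -> G) k : ind_morphism V V f ->
  exists m0, forall m, (m0 <= m)%N -> exists P : piece V k -> piece V m,
    kmorphism P /\ forall y, inc m (P y) = f (inc k y).
Proof.
move=> /(_ k)[m0 [P [kP PE]]]; exists m0 => m /transition[t [[kt _ _] tE]].
exists (t \o P); split=> [|y]; first exact: kmorphism_comp.
by rewrite /= tE PE.
Qed.

Lemma mul_level k : exists m0, forall m, (m0 <= m)%N ->
  exists M : kprod (piece V k) (piece V k) -> piece V m,
    kmorphism M /\ forall p, inc m (M p) = (inc k p.1 * (inc k p.2)^-1)%g.
Proof.
have [_ /(_ k)[m0 [M [kM ME]]]] := indG; exists m0 => m /transition[t [[kt _ _] tE]].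
exists (t \o M); split=> [|p]; first exact: kmorphism_comp.
by rewrite /= tE ME.
Qed.

Lemma ind_morphism_cst c : ind_morphism V V (fun=> c).
Proof.
move=> k; have [[_ _ /(_ c)[m [y yc]] _] _] := indG.
by exists m, (fun=> y); split=> //; apply: kmorphism_cst.
Qed.

Lemma ind_morphism_id : ind_morphism V V id.
Proof. by move=> k; exists k, id; split=> //; apply: kmorphism_id. Qed.

Lemma ind_morphism_mulV (f g : G -> G) : ind_morphism V V f -> ind_morphism V V g ->
  ind_morphism V V (fun x => f x * (g x)^-1)%g.
Proof.
move=> mf mg k; have [a fa] := ind_morphism_level k mf.
have [b gb] := ind_morphism_level k mg.
have [P [kP PE]] := fa _ (leq_maxl a b); have [Q [kQ QE]] := gb _ (leq_maxr a b).
have [m0 /(_ m0 (leqnn m0))[M [kM ME]]] := mul_level (maxn a b).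
exists m0, (fun x => M (P x, Q x)); split=> [|y]; last by rewrite ME /= PE QE.
exact: kmorphism_comp (pair_kmorphism (ind_piece_variety k) kP kQ) kM.
Qed.

Lemma ind_morphism_inv : ind_morphism V V (fun x => x^-1)%g.
Proof.
have := ind_morphism_mulV (ind_morphism_cst 1%g) ind_morphism_id.
by congr (ind_morphism V V _); apply/funext => x; rewrite mul1g.
Qed.

Lemma ind_morphism_pow j : ind_morphism V V (fun x => x ^+ j)%g.
Proof.
elim: j => [|j IH]; first exact: ind_morphism_cst.
have := ind_morphism_mulV IH ind_morphism_inv.
by congr (ind_morphism V V _); apply/funext => x; rewrite invgK expgSr.
Qed.

(** [F] is an extension of [f] on a neighbourhood [N] in the larger piece, and 0 elsewhere. It
    vanishes on the whole of [A] because a point of [A] in [N] comes from piece [l], where [N]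
    restricts to a set on which the extension agrees with [f] and [f] is zero on [A]. *)
Lemma extend_germ (A : set G) l m (e : piece V l) (e' : piece V m) f :
  (l <= m)%N -> inc m e' = inc l e -> A `<=` range (inc l) ->
  regular_at e f -> (\forall y \near e, A (inc l y) -> f y = 0) ->
  exists F : G -> K, [/\ regular_at e' (F \o inc m),
    \forall y \near e, F (inc l y) = f y & forall g, A g -> F g = 0].
Proof.
move=> lm e'e Al rf fA; have [t [[kt tN tR] tE]] := transition lm.
have te : t e = e' by apply: ind_inc_inj; rewrite tE.
have [h [rh fh]] := tR e f rf; rewrite te in rh.
have [N [nN NA]] := tN _ _ (filterI fA fh); rewrite te in nN.
pose F g := if pselect (exists y, N y /\ inc m y = g) is left ex then h (sval (cid ex)) else 0.
have FE y : N y -> F (inc m y) = h y.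
  rewrite /F; case: pselect => [ex _|no Ny]; last by case: no; exists y.
  by case: cid => z [_] /= /ind_inc_inj ->.
exists F; split.
- apply: regular_at_near rh; apply: filterS nN => y Ny /=; exact/esym/FE.
- have nN' : nbhs e (t @^-1` N) by apply: continuous_nbhs kt.1 _; rewrite te.
  by apply: filterS nN' => y Ny; rewrite -tE FE //; have [_ /= ->] := NA y Ny.
- move=> g Ag; rewrite /F; case: pselect => // ex.
  case: cid => z [Nz zg] /=; have [y _ yg] := Al g Ag.
  have ty : t y = z by apply: ind_inc_inj; rewrite tE yg zg.
  rewrite -ty in Nz *; have [/= fy0 <-] := NA y Nz.
  by apply: fy0; rewrite yg.
Qed.

(** [m0] comes before [F], since the level receiving the products must be known before a germ is
    extended to it. The product is obtained from the given division as f(x) (y^-1)^-1. *)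
Lemma product_bigerm (f : G -> G) l (e : piece V l) :
  ind_morphism V V f -> inc l e = 1%g -> f 1%g = 1%g ->
  exists m0, forall m (e' : piece V m) (F : G -> K), (m0 <= m)%N -> inc m e' = 1%g ->
    regular_at e' (F \o inc m) ->
    exists a h N, [/\ bigerm e a, bigerm e h, h e e != 0, nbhs e N &
      forall x y, N x -> N y -> F (f (inc l x) * inc l y)%g * h x y = a x y].
Proof.
move=> mf e1 f1; have [a fa] := ind_morphism_level l mf.
have [b gb] := ind_morphism_level l ind_morphism_inv.
have [P [kP PE]] := fa _ (leq_maxl a b); have [Q [kQ QE]] := gb _ (leq_maxr a b).
have [m0 Mm] := mul_level (maxn a b); exists m0 => m e' F /Mm[M [kM ME]] e'1 rF.
have ME' x y : inc m (M (P x, Q y)) = (f (inc l x) * inc l y)%g.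
  by rewrite ME /= PE QE invgK.
have Me : M (P e, Q e) = e' by apply: ind_inc_inj; rewrite ME' e1 f1 mulg1.
rewrite -Me in rF.
have [A [B [N [bA bB B0 nN E]]]] := bigerm_pullback kP kQ kM rF.
by exists A, B, N; split=> // x y Nx Ny; rewrite -ME' -E.
Qed.

(* If f vanishes on the subgroup A, then f(xy) - f(x) - f(y) vanishes on
   A x A and on the two axes, so that f(x^d) is d f(x) up to an element of m J,
   where m is the maximal ideal at 1 and J the ideal of A. *)
Lemma local_roots (A : set G) l (e : piece V l) d :
  [pchar K]%R =i pred0 -> (0 < d)%N -> inc l e = 1%g -> A 1%g ->
  (forall x y, A x -> A y -> A (x * y)%g) -> closed (inc l @^-1` A) ->
  A `<=` range (inc l) ->
  \forall x \near e, A (inc l x ^+ d)%g -> A (inc l x).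
Proof.
move=> char0 d0 e1 A1 AM cA Al; have vX := ind_piece_variety l.
have AX x j : A x -> A (x ^+ j)%g.
  by move=> Ax; elim: j => // j IH; rewrite expgS; apply: AM.
have [r [q [rq qA Aq gen]]] := vanishing_germs_generated e vX cA.
suff roots i : exists g, max_mul e q g /\
    \forall x \near e, A (inc l x ^+ d)%g -> d%:R * q i x + g x = 0.
  have dn0 : d%:R != 0 :> K by rewrite ((pcharf0P K).1 char0) -lt0n.
  have := nakayama vX dn0 roots; apply: filterS2 Aq => x Aqx qx Axd.
  by apply: Aqx => i; apply: qx.
have pow1 j : (1 ^+ j = 1 :> G)%g by rewrite expg1n.
have /choice[m0 m0P] j := product_bigerm (ind_morphism_pow j) e1 (pow1 j).
(* One level above [l] and above every [m0 j] with j < d, so that a single extension [F] serves all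
   exponents. *)
pose m := (l + \sum_(j < d) m0 j)%N.
have m0m j : (j < d)%N -> (m0 j <= m)%N.
  move=> jd; apply: leq_trans (leq_addl _ _).
  by rewrite (bigD1 (Ordinal jd)) //= leq_addr.
have lm : (l <= m)%N by exact: leq_addr.
have [t [_ tE]] := transition lm.
have te1 : inc m (t e) = 1%g by rewrite tE.
have [F [rF Fq FA]] := extend_germ lm (tE e) Al (rq i) (qA i).
pose phi j x := F (inc l x ^+ j)%g.
have phie j : phi j e = 0 by rewrite /phi e1 pow1; apply: FA.
have phi1 : \forall x \near e, phi 1%N x = q i x by exact: Fq.
have rphi1 : regular_at e (phi 1%N).
  by apply: regular_at_near (rq i); apply: filterS phi1 => x ->.
(* The failure of additivity of [F] at the pair (x^j, x); these terms telescope in [steps]. *)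
have step j : (j < d)%N -> max_mul e q (fun x => phi j.+1 x - phi j x - phi 1%N x).
  move=> jd; have [a [h [N [ba bh h0 nN E]]]] := m0P j m (t e) F (m0m j jd) te1 rF.
  have Ne := nbhs_singleton nN.
  (* Setting y = 1 in the fraction for F(x^j y) exhibits F(x^j) as a regular germ. *)
  have rphi : regular_at e (phi j).
    have [rV nV] := regular_at_inv vX (bigerm_left bh) h0.
    apply: regular_at_near (regular_atM (bigerm_left ba) rV).
    apply: filterS2 nN nV => x Nx hx; rewrite -E // e1 mulg1 mulfK //.
  (* The additivity defect times the denominator [h]; the factors 1 give the terms the shape
     expected by [bigerm_prod]. *)
  pose T x y := a x y - phi j x * 1 * h x y - 1 * phi 1%N y * h x y.
  have TE x y : N x -> N y -> T x y = (F (inc l x ^+ j * inc l y)%g - phi j x - phi 1%N y) * h x y.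
    by move=> Nx Ny; rewrite /T -E //; ring.
  have bT : bigerm e T.
    apply: bigermB.
      by apply: bigermB => //; apply: bigermM => //; apply: bigerm_prod => //; apply: regular_at_cst.
    by apply: bigermM => //; apply: bigerm_prod => //; apply: regular_at_cst.
  have mT : max_mul e q (fun x => T x x).
    apply: (max_mul_bigerm gen bT nN) => [x Nx|x Nx|x y Nx Ny Ax Ay].
    - by rewrite TE // e1 mulg1 -/(phi j x) phie !subr0 subrr mul0r.
    - by rewrite TE // phie e1 pow1 mul1g subr0 /phi expg1 subrr mul0r.
    - have Axj : A (inc l x ^+ j)%g by apply: AX.
      by rewrite TE // /phi expg1 !FA ?subr0 ?mul0r //; apply: AM.
  have [rV nV] := regular_at_inv vX (bigerm_diag bh) h0.
  apply: max_mul_near (max_mulZ rV mT); apply: filterS2 nN nV => x Nx hx.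
  by rewrite TE // mulrC mulfK // -expgSr.
have steps j : (j <= d)%N -> max_mul e q (fun x => phi j x - j%:R * phi 1%N x).
  elim: j => [_|j IH jd].
    apply: max_mul_near (max_mul0 e q); apply: nbhsW => x.
    by rewrite mul0r subr0 /phi expg0 FA.
  apply: max_mul_near (max_mulD (IH (ltnW jd)) (step j jd)); apply: nbhsW => x.
  by rewrite -natr1; ring.
exists (fun x => phi d x - d%:R * phi 1%N x); split; first exact: steps.
apply: filterS phi1 => x -> Axd.
by rewrite /phi FA // sub0r addrN.
Qed.

End IndGroup.

(** * Openness of a subgroup exhausted by algebraic subgroups *)

Section Exhausted.
Variables (K : closedFieldType) (G : groupType) (V : filtration K G).
Hypothesis char0 : [pchar K]%R =i pred0.
Hypothesis uncountableK : ~ countable [set: K].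
Hypothesis indG : ind_group V.
Variables (H : set G) (A : nat -> set G).
Hypothesis HA : H = \bigcup_n A n.
Hypothesis A1 : forall n, A n 1%g.
Hypothesis AM : forall n x y, A n x -> A n y -> A n (x * y)%g.
Hypothesis AS : forall n, A n `<=` A n.+1.
Hypothesis A_closed : forall n k, closed (@inc K G V k @^-1` A n).
Hypothesis A_algebraic : forall n, exists l, A n `<=` range (@inc K G V l).
Hypothesis powersH : forall g, exists d, (0 < d)%N /\ H (g ^+ d)%g.

Local Notation inc k := (@inc K G V k).

Lemma exhausted_pow n x j : A n x -> A n (x ^+ j)%g.
Proof.
move=> Ax; elim: j => [|j IH]; first exact: A1.
by rewrite expgS; apply: AM.
Qed.

Lemma exhausted_mono n m : (n <= m)%N -> A n `<=` A m.
Proof.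
elim: m => [|m IH]; first by rewrite leqn0 => /eqP ->.
rewrite leq_eqVlt => /predU1P[-> //|/IH nm]; exact: subset_trans nm (@AS m).
Qed.

Lemma exhausted_near1 k (e : piece V k) : inc k e = 1%g -> nbhs e (inc k @^-1` H).
Proof.
move=> e1.
(* Factorials divide one another, so the sets increase, and every exponent [d] divides all
   factorials from d! on, so they cover. *)
pose F n := [set x : piece V k | A n (inc k x ^+ n`!)%g].
have [n|n m nm x|x|n nF] := @closed_cover_stationary K _ e F uncountableK (ind_piece_variety indG k).
- have [m [P [kP PE]]] := ind_morphism_pow indG n`! k.
  have -> : F n = P @^-1` (inc m @^-1` A n).
    by apply/seteqP; split=> x; rewrite /F /= PE.
  by have /continuous_closedP := kP.1; apply.
- elim: m nm => [|m IH]; first by rewrite leqn0 => /eqP ->.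
  rewrite leq_eqVlt => /predU1P[->//|/IH FF] /FF Fx.
  by rewrite /F /= factS mulnC expgnA; apply/exhausted_pow/AS.
- have [d [d0]] := powersH (inc k x); rewrite HA => -[i _ Ai].
  exists (maxn d i); rewrite /F /=; have /dvdnP[c ->] : (d %| (maxn d i)`!)%N.
    by rewrite dvdn_fact // d0 leq_maxl.
  rewrite mulnC expgnA; apply/exhausted_pow.
  by apply: exhausted_mono Ai; apply: leq_maxr.
(* [local_roots] needs a piece containing [A n]: it is applied in a piece above both [k] and [l0],
   and its conclusion is pulled back along [t]. *)
have [l0 Al0] := A_algebraic n.
have [t [[kt _ _] tE]] := transition indG (leq_maxl k l0).
have [u [_ uE]] := transition indG (leq_maxr k l0).
have te1 : inc _ (t e) = 1%g by rewrite tE.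
have Al : A n `<=` range (inc (maxn k l0)).
  by move=> g /Al0[y _ <-]; exists (u y).
have := local_roots indG char0 (fact_gt0 n) te1 (A1 n) (@AM n) (@A_closed n _) Al.
move=> /(continuous_nbhs kt.1); apply: filterS2 nF => x Fx.
by rewrite /= tE => /(_ Fx) Ax; rewrite HA; exists n.
Qed.

Lemma exhausted_open : (forall x y, H x -> H y -> H (x * y)%g) ->
  open (H : set (ind_point V)).
Proof.
move=> HM; suff : ind_open V H by [].
move=> k; rewrite openE => p Hp.
(* Right translation by the inverse of the point [p] moves it to 1 but may leave piece [k], so the
   result at 1 is used in another piece [m]. *)
have [m [P [kP PE]]] := ind_morphism_mulV indG (@ind_morphism_id K G V)
  (ind_morphism_cst indG (inc k p)) k.
have /exhausted_near1 : inc m (P p) = 1%g by rewrite PE mulgV.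
move=> /(continuous_nbhs kP.1); apply: filterS => x /= HPx.
by rewrite -(mulgVK (inc k p) (inc k x)) -PE; apply: HM.
Qed.

End Exhausted.

Lemma ksub_closed_image (K : closedFieldType) (X : kspace K) (Z : set X)
    (C : set (ksub Z)) :
  closed Z -> closed C -> closed [set x | exists z : ksub Z, C z /\ set_val z = x].
Proof.
move=> cZ; rewrite -openC => -[O oO OC].
have -> : [set x | exists z : ksub Z, C z /\ set_val z = x] = Z `&` ~` O.
  apply/seteqP; split=> x.
    move=> [z [Cz <-]]; split; first exact: set_valP.
    by move=> Oz; have : (set_val @^-1` O) z by []; rewrite OC.
  move=> [Zx nO]; exists (exist _ x (mem_set Zx)); split=> //.
  apply: contrapT => nC.
  have : (~` C) (exist _ x (mem_set Zx)) by [].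
  by rewrite -OC.
by apply: closedI => //; rewrite closedC.
Qed.

Theorem theorem3p1 (K : closedFieldType)
    (char0 : [pchar K]%R =i pred0) (uncountableK : ~ countable [set: K])
    (G : groupType) (V : filtration K G)
    (indG : ind_group V) (connectedG : ind_connected V)
    (H : subgroup G) (closedH : ind_closed V H)
    (connectedH : ind_connected (ind_subgroup V H))
    (nestedH : nested (ind_subgroup V H))
    (powersH : forall g : G, exists d : nat, (0 < d)%N /\ (H : set G) (g ^+ d)%g) :
  [set: G] = H.
Proof.
have [V' [[_ _ coverV' embV'] _ algV']] := nestedH.
pose A n : set G := [set val h | h in range (@inc K _ V' n)].
have closed_piece (T : choiceType) (U : filtration K T) (C : set T) :
    closed (C : set (ind_point U)) -> forall k, closed (@inc K T U k @^-1` C).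
  rewrite -openC => oC k; rewrite -openC.
  by have : ind_open U (~` C) by []; apply.
have Hsub := subgroup_closed H.
have HM x y : (H : set G) x -> (H : set G) y -> (H : set G) (x * y)%g.
  by move=> Hx Hy; apply: set_mem; apply: (group_closedM Hsub); apply: mem_set.
have HA : H = \bigcup_n A n :> set G.
  apply/seteqP; split=> [g Hg|_ [n _ [h _ <-]]]; last exact/set_mem/(valP h).
  have [n [y yE]] := coverV' (Sub g (mem_set Hg) : subgroup_type H).
  by exists n => //; exists (inc y); [exists y | rewrite yE SubK].
have oH : open ((H : set G) : set (ind_point V)).
  apply: (exhausted_open char0 uncountableK indG HA) => //.
  - move=> n; have [[one _] _ _] := algV' n.
    by exists 1%g; [exact: set_mem one | exact: val1].
  - move=> n _ _ [h rh <-] [h' rh' <-]; have [gr _ _] := algV' n.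
    exists (h * h')%g; last by rewrite valM.
    by apply: set_mem; apply: (group_closedM gr); apply: mem_set.
  - move=> n _ [_ [y _ <-] <-]; have [t [_ tE]] := embV' n.
    by exists (inc (t y)); [exists (t y) | rewrite tE].
  (* [A n] is closed for the filtration that [V] induces on [H]; since [H] is closed in [G], its
     trace on each piece of [G] is closed too. *)
  - move=> n k; have [_ cA _] := algV' n.
    have := ksub_closed_image (closed_piece _ _ _ closedH k)
      (closed_piece _ _ _ cA k).
    congr closed; apply/seteqP; split=> x.
      by move=> [z [rz <-]]; exists (@inc K _ (ind_subgroup V H) k z).
    move=> [h rh hx].
    have Hx : (inc x) \in (H : set G) by rewrite -hx; exact: valP h.
    have Hx' : x \in (@inc K G V k @^-1` (H : set G)) by apply: mem_set; exact: set_mem Hx.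
    exists (exist _ x Hx'); split=> //=.
    have hE : h = @inc K _ (ind_subgroup V H) k (exist _ x Hx').
      by apply: val_inj; rewrite /= hx.
    by rewrite hE in rh.
  - move=> n; have [_ _ [l Al]] := algV' n; exists l => _ [h /Al[y _ <-] <-].
    by exists (val y).
apply/esym/connectedG.
- by exists 1%g; apply: set_mem; case: Hsub.
- by exists (H : set G) => //; rewrite setTI.
- by exists (H : set G) => //; rewrite setTI.
Qed.
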